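(* Let $n\ge 2$ and let $f:\mathbb S^n\to\mathbb C$ be such that $f\in C^1(\mathbb S^n)$, $|f|\in C^1(\mathbb S^n)$ and $\int_{\mathbb S^n}|f(x)|^2d\sigma(x)=1$. Then $$\mathrm V_{x,f}\int_{\mathbb S^n}|\nabla_{\mathbb S^n}f(x)|^2d\sigma(x)\;\geq\;\frac{n^2}{4}|\tau_f|^2+\mathrm{COV}^2 .$$
   Context: $\mathbb S^n=\{x=(x_0,\dots,x_n)^T\in\mathbb R^{n+1}:|x|=1\}$ with normalized surface measure $\sigma$. Spherical gradient: for a $C^1$ function $f$ on $\mathbb S^n$, $\nabla_{\mathbb S^n}f=(\Gamma_0f,\dots,\Gamma_nf)^T$ is defined by $\nabla_{\mathbb S^n}f(x)=\nabla F(x)$ for $x\in\mathbb S^n$, where $F(y)=f(y/|y|)$ on $\mathbb R^{n+1}\setminus\{0\}$ and $\nabla$ is the Euclidean gradient in $\mathbb R^{n+1}$. (So $x\cdot\nabla_{\mathbb S^n}f(x)=0$.) Norms of vectors in $\mathbb C^{n+1}$ are Hermitian norms. Phase derivative of $f=u+iv$ on $\mathbb S^n$: at points where $f(x)\ne0$, $$\Phi_f'(x)=\frac{\nabla_{\mathbb S^n} f(x)}{2if(x)}-\frac{\nabla_{\mathbb S^n} \overline{f(x)}}{2i\,\overline{f(x)}}=\frac{u\nabla_{\mathbb S^n}v-v\nabla_{\mathbb S^n}u}{|f|^2}(x).$$ Integrands containing the product of a positive power of $|f(x)|$ with $\Phi_f'(x)$ are taken to be $0$ where $f(x)=0$. Definitions,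 for $f$ with $\int_{\mathbb S^n}|f|^2d\sigma=1$: - $\tau_f=\int_{\mathbb S^n}x|f(x)|^2d\sigma(x)\in\mathbb R^{n+1}$; - $\mathrm V_{x,f}=\int_{\mathbb S^n}|x-\tau_f|^2|f(x)|^2d\sigma(x)=1-|\tau_f|^2$; - $\mathrm{COV}=\int_{\mathbb S^n}|x-\tau_f|\,|\Phi_f'(x)|\,|f(x)|^2d\sigma(x)$. *)

(* Defs.v *)
From HB Require Import structures.
From mathcomp Require Import all_boot all_order all_algebra.
From mathcomp Require Import complex.
From mathcomp Require Import all_classical all_reals all_analysis.
From mathcomp Require Import measurable_realfun ring lra.

Set Implicit Arguments.
Unset Strict Implicit.
Unset Printing Implicit Defensive.

Import Order.TTheory GRing.Theory Num.Theory.
Import numFieldNormedType.Exports.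

Local Open Scope classical_set_scope.
Local Open Scope ring_scope.

(* Product sigma-algebra on row vectors (as for tuples in the library); over the
   reals it is the Borel one. *)
Definition measure_row_display : measure_display -> measure_display.
Proof. exact. Qed.

Section measurable_row.
Context {d} {T : measurableType d} (n : nat).

Let coors : 'I_n -> 'rV[T]_n -> T := fun i v => v ord0 i.

Let row_set0 : g_sigma_preimage coors set0.
Proof. exact: sigma_algebra0. Qed.

Let row_setC A : g_sigma_preimage coors A -> g_sigma_preimage coors (~` A).
Proof. exact: sigma_algebraC. Qed.

Let row_bigcup (F : _^nat) : (forall i, g_sigma_preimage coors (F i)) ->
  g_sigma_preimage coors (\bigcup_i (F i)).
Proof. exact: sigma_algebra_bigcup. Qed.

HB.instance Definition _ := @isMeasurable.Build (measure_row_display d)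
  'rV[T]_n (g_sigma_preimage coors) row_set0 row_setC row_bigcup.

End measurable_row.
Section measurable_row_lemmas.
Context d1 d2 (T1 : measurableType d1) (T2 : measurableType d2).

Lemma measurable_row_coord n (i : 'I_n) :
  measurable_fun [set: 'rV[T2]_n] (fun v : 'rV[T2]_n => v ord0 i).
Proof.
move=> _ Y mY; rewrite setTI; apply: sub_sigma_algebra => /=.
rewrite -bigcup_seq/=; exists i => /=; first by rewrite mem_index_enum.
by exists Y => //; rewrite setTI.
Qed.

Lemma measurable_fun_row n (f : T1 -> 'rV[T2]_n) :
  (forall i, measurable_fun [set: T1] (fun x => f x ord0 i)) ->
  measurable_fun [set: T1] f.
Proof.
move=> mf _ A mA.
suff : g_sigma_preimage (fun (i : 'I_n) (x : T1) => f x ord0 i) `<=` measurable.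
  rewrite (g_sigma_preimage_comp (fun i (v : 'rV[T2]_n) => v ord0 i)).
  by apply; exists A.
apply: smallest_sub; first exact: sigma_algebra_measurable.
case: n => [|n] in f mf A mA *; first by rewrite big_ord0.
rewrite -bigcup_mkord_ord; apply: bigcup_sub => i Ii.
by move=> B [C mC <-]; exact: mf.
Qed.

End measurable_row_lemmas.
Section row_cons.
Context {R : realType}.

Definition row_cons n (p : measurableTypeR R * 'rV[R]_n) : 'rV[R]_n.+1 :=
  \row_(i < n.+1) if unlift ord0 i is Some j then p.2 ord0 j else p.1.

Definition row_uncons n (v : 'rV[R]_n.+1) : measurableTypeR R * 'rV[R]_n :=
  (v ord0 ord0, \row_i v ord0 (lift ord0 i)).

Lemma row_consK n : cancel (@row_cons n) (@row_uncons n).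
Proof.
move=> [x v]; congr pair; first by rewrite mxE unlift_none.
by apply/rowP => i; rewrite !mxE liftK.
Qed.

Lemma row_unconsK n : cancel (@row_uncons n) (@row_cons n).
Proof.
by move=> v; apply/rowP => i; rewrite mxE; case: unliftP => [j|] ->; rewrite ?mxE.
Qed.

Lemma measurable_row_cons n : measurable_fun setT (@row_cons n).
Proof.
apply: measurable_fun_row => i; rewrite /row_cons.
under eq_fun do rewrite mxE.
case: (unlift _ i) => [j|].
- apply: (@measurableT_comp _ _ _ _ _ _ (fun v : 'rV[R]_n => v ord0 j)) => //.
  exact: measurable_row_coord.
- exact: (@measurable_fst _ _ (measurableTypeR R)).
Qed.

Lemma measurable_row_uncons n : measurable_fun setT (@row_uncons n).
Proof.
apply: measurable_fun_pair; first exact: measurable_row_coord.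
apply: measurable_fun_row => i.
under eq_fun do rewrite mxE.
exact: measurable_row_coord.
Qed.

HB.instance Definition _ n := isMeasurableFun.Build _ _ _ _ (@row_cons n)
  (@measurable_row_cons n).

End row_cons.

Section lebesgue_row.
Context {R : realType}.

Section successor.
Variables (n : nat) (mu : {sigma_finite_measure set 'rV[R]_n -> \bar R}).

Definition lebesgue_row_succ : set 'rV[R]_n.+1 -> \bar R :=
  pushforward (@lebesgue_measure R \x mu)%E (@row_cons R n).

Let succ0 : lebesgue_row_succ set0 = 0%E.
Proof. exact: measure0. Qed.

Let succ_ge0 A : (0 <= lebesgue_row_succ A)%E.
Proof. exact: measure_ge0. Qed.

Let succ_sigma_additive : semi_sigma_additive lebesgue_row_succ.
Proof. exact: measure_semi_sigma_additive. Qed.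

HB.instance Definition _ := isMeasure.Build _ _ _ lebesgue_row_succ
  succ0 succ_ge0 succ_sigma_additive.

Let succ_sigma_finite : sigma_finite setT lebesgue_row_succ.
Proof.
have /sigma_finiteP[F [TF ndF Foo]] := sigma_finiteT (@lebesgue_measure R).
have /sigma_finiteP[G [TG ndG Goo]] := sigma_finiteT mu.
exists (fun k => @row_uncons R n @^-1` (F k `*` G k)).
  rewrite -preimage_bigcup -[LHS](preimage_setT (@row_uncons R n)).
  congr (_ @^-1` _); rewrite -setXTT TF TG predeqE => -[x y]; split.
    move=> [/= [i _ Fix] [j _ Gjy]]; exists (maxn i j) => //; split.
    - by move: x Fix; exact/subsetPset/ndF/leq_maxl.
    - by move: y Gjy; exact/subsetPset/ndG/leq_maxr.
  by move=> [i _ []/= ? ?]; split; exists i.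
move=> k; have [mF Fk] := Foo k; have [mG Gk] := Goo k.
have mFG : measurable (F k `*` G k) by exact: measurableX.
split.
  by rewrite -[X in measurable X]setTI; exact: measurable_row_uncons.
rewrite /lebesgue_row_succ /pushforward -comp_preimage.
rewrite (_ : _ \o _ = id); last by apply/funext => x; exact: row_consK.
rewrite preimage_id product_measure1E//.
by rewrite lte_mul_pinfty// ge0_fin_numE.
Qed.

HB.instance Definition _ := @Measure_isSigmaFinite.Build _ _ _
  lebesgue_row_succ succ_sigma_finite.

End successor.

Fixpoint lebesgue_row n : {sigma_finite_measure set 'rV[R]_n -> \bar R} :=
  match n with
  | 0 => \d_(0 : 'rV[R]_0)
  | m.+1 => lebesgue_row_succ (lebesgue_row m)
  end.

End lebesgue_row.

Section euclidean.
Context {R : realType}.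

(* The library norm on ['rV[R]_n] is the sup norm; it is used here only through
   its topology. *)
Definition enorm n (v : 'rV[R]_n) : R := Num.sqrt (\sum_(i < n) v ord0 i ^+ 2).

Definition hnorm n (z : 'rV[R[i]]_n) : R :=
  Num.sqrt (\sum_(i < n) Normc.normc (z ord0 i) ^+ 2).

Definition sphere n : set 'rV[R]_n := [set x | enorm x = 1].

Definition unit_ball n : set 'rV[R]_n := [set x | enorm x <= 1].

(* Since [0^-1 = 0], the origin (which lies outside the sphere) is sent to
   itself. *)
Definition radial_proj n (y : 'rV[R]_n) : 'rV[R]_n := (enorm y)^-1 *: y.

Lemma measurable_enorm n : measurable_fun setT (@enorm n).
Proof.
rewrite (_ : @enorm n = @Num.sqrt R \o
  (fun v : 'rV[R]_n => \sum_(i < n) v ord0 i ^+ 2))//.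
apply: measurableT_comp.
  by apply: continuous_measurable_fun; exact: sqrt_continuous.
apply: measurable_sum => i.
by apply: measurable_funX; exact: measurable_row_coord.
Qed.

Lemma measurable_unit_ball n : measurable (@unit_ball n).
Proof.
rewrite [X in measurable X](_ : _ = @enorm n @^-1` `]-oo, 1]).
  by rewrite -[X in measurable X]setTI; exact: measurable_enorm.
by apply/seteqP; split => x /=; rewrite in_itv.
Qed.

Lemma measurable_sphere n : measurable (@sphere n).
Proof.
rewrite -[X in measurable X]setTI.
exact: (measurable_enorm measurableT (measurable_set1 (1 : R))).
Qed.

Lemma measurable_radial_proj n : measurable_fun setT (@radial_proj n).
Proof.
apply: measurable_fun_row => i.
under eq_fun do rewrite mxE.
apply: measurable_funM; last exact: measurable_row_coord.
rewrite (_ : (fun _ => _) = (@powR R ^~ (-1)) \o @enorm n).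
  by apply: measurableT_comp => //; exact: measurable_enorm.
by apply/funext => y /=; rewrite powR_inv1// sqrtr_ge0.
Qed.

HB.instance Definition _ n := isMeasurableFun.Build _ _ _ _ (@radial_proj n)
  (@measurable_radial_proj n).

Definition cube n (a : R) : set 'rV[R]_n := [set v | forall i, v ord0 i \in `[- a, a]].

Lemma cubeS n a : @cube n.+1 a =
  @row_uncons R n @^-1` ([set` `[- a, a]] `*` @cube n a).
Proof.
apply/seteqP; split => v /=.
  by move=> av; split => //= i; rewrite mxE; exact: av.
move=> [/= v0 av] i; case: (unliftP ord0 i) => [j|] ->; last exact: v0.
by have := av j; rewrite mxE.
Qed.

Lemma measurable_cube n a : measurable (@cube n a).
Proof.
elim: n => [|n ih].
  by rewrite [X in measurable X](_ : _ = setT)//; apply/seteqP; split => // v _ [].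
rewrite cubeS -[X in measurable X]setTI.
apply: measurable_row_uncons => //; apply: measurableX => //.
Qed.

Lemma lebesgue_row_cube n a : 0 <= a ->
  lebesgue_row n (@cube n a) = ((2 * a) ^+ n)%:E.
Proof.
move=> a0; elim: n => [|n ih].
  by rewrite /= diracE mem_set//; case.
rewrite /= /lebesgue_row_succ /pushforward cubeS -comp_preimage.
rewrite (_ : _ \o _ = id); last by apply/funext => x; exact: row_consK.
rewrite preimage_id product_measure1E//; last exact: measurable_cube.
have lebE : @lebesgue_measure R `[- a, a]%classic = (2 * a)%:E.
  rewrite lebesgue_measure_itv/= lte_fin.
  case: ltP => [_|aa]; first by rewrite -EFinD; congr EFin; ring.
  by congr EFin; lra.
by rewrite exprS EFinM -ih -lebE.
Qed.

Lemma lebesgue_row_ball_lty n : (lebesgue_row n (@unit_ball n) < +oo)%E.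
Proof.
apply: (@le_lt_trans _ _ (lebesgue_row n (@cube n 1))); last first.
  by rewrite lebesgue_row_cube// ltry.
apply: le_measure; rewrite ?inE; [exact: measurable_unit_ball|exact: measurable_cube|].
move=> v /= v1 i; rewrite in_itv/= -ler_norml -sqrtr_sqr (le_trans _ v1)//.
rewrite ler_sqrt ?sumr_ge0// => [|j _]; last exact: sqr_ge0.
by rewrite (bigD1 i)//= lerDl sumr_ge0// => j _; exact: sqr_ge0.
Qed.

Lemma lebesgue_row_ball_gt0 n : (0 < lebesgue_row n (@unit_ball n))%E.
Proof.
apply: (@lt_le_trans _ _ (lebesgue_row n (@cube n n.+1%:R^-1))).
  by rewrite lebesgue_row_cube// lte_fin exprn_gt0// mulr_gt0// invr_gt0.
apply: le_measure; rewrite ?inE; [exact: measurable_cube|exact: measurable_unit_ball|].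
move=> v /= vn; rewrite /unit_ball /= -[leRHS]sqrtr1 ler_sqrt//.
apply: (@le_trans _ _ (\sum_(i < n) n.+1%:R^-1)).
  apply: ler_sum => i _; rewrite -real_normK ?num_real//.
  have := vn i; rewrite in_itv/= -ler_norml => vi.
  rewrite expr2 (le_trans (ler_pM _ _ vi vi))//.
  by rewrite ler_piMl// invf_le1// ler1n.
rewrite sumr_const card_ord -[_ *+ n]mulr_natl ler_pdivrMr// mul1r ler_nat.
exact: leqnSn.
Qed.

End euclidean.
Arguments sphere {R} n.
Arguments unit_ball {R} n.

Section sphere_measure.
Context {R : realType} (n : nat).

Let lambda := lebesgue_row n : {measure set 'rV[R]_n -> \bar R}.

(* Cone-measure form of the normalized surface measure: the surface area of [A]
   in the sphere is [n] times the volume of the cone [{t x | x in A, 0 < t <= 1}],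
   so the normalized area is the proportion of the ball filled by the cone.
   It is carried by the sphere, see [sphere_measure_sphere]. *)
Definition sphere_measure (A : set 'rV[R]_n) : \bar R :=
  (((fine (lambda (unit_ball n)))^-1)%:E *
   lambda (@radial_proj R n @^-1` A `&` unit_ball n))%E.

Let c_ge0 : 0 <= (fine (lambda (unit_ball n)))^-1.
Proof. by rewrite invr_ge0 fine_ge0. Qed.

Let nu : {measure set 'rV[R]_n -> \bar R} :=
  mscale (NngNum c_ge0) (mrestr lambda (@measurable_unit_ball R n)).

Let sphere_measure0 : sphere_measure set0 = 0%E.
Proof. exact: (measure0 nu). Qed.

Let sphere_measure_ge0 A : (0 <= sphere_measure A)%E.
Proof. exact: (measure_ge0 nu). Qed.

Let sphere_measure_sigma_additive : semi_sigma_additive sphere_measure.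
Proof.
have : semi_sigma_additive (pushforward nu (@radial_proj R n)).
  exact: measure_semi_sigma_additive.
exact.
Qed.

HB.instance Definition _ := isMeasure.Build _ _ _ sphere_measure
  sphere_measure0 sphere_measure_ge0 sphere_measure_sigma_additive.

Let ballE : (((fine (lambda (unit_ball n)))^-1)%:E *
  lambda (unit_ball n) = 1)%E.
Proof.
have B0 : (0 < lambda (unit_ball n))%E by exact: lebesgue_row_ball_gt0.
have Boo : (lambda (unit_ball n) < +oo)%E by exact: lebesgue_row_ball_lty.
rewrite -[X in (_ * X)%E]fineK ?ge0_fin_numE// -EFinM mulVf//.
by rewrite gt_eqF// fine_gt0// B0 Boo.
Qed.

Let sphere_measureT : sphere_measure setT = 1%E.
Proof. by rewrite /sphere_measure preimage_setT setTI ballE. Qed.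

HB.instance Definition _ := Measure_isProbability.Build _ _ _
  sphere_measure sphere_measureT.

End sphere_measure.
Arguments sphere_measure {R} n.


Lemma enorm_eq0 (R : realType) n (v : 'rV[R]_n) : (enorm v == 0) = (v == 0).
Proof.
have s0 : 0 <= \sum_(i < n) v ord0 i ^+ 2.
  by rewrite sumr_ge0// => i _; exact: sqr_ge0.
rewrite sqrtr_eq0 (_ : (_ <= 0) = (\sum_(i < n) v ord0 i ^+ 2 == 0)); last first.
  by rewrite eq_le s0 andbT.
rewrite psumr_eq0 => [|i _]; last exact: sqr_ge0.
apply/allP/eqP => [v0|-> i _]; last by rewrite mxE expr0n /=.
apply/rowP => i; rewrite mxE; apply/eqP.
by rewrite -sqrf_eq0; apply: (v0 i); rewrite mem_index_enum.
Qed.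

Lemma enormZ (R : realType) n (a : R) (v : 'rV[R]_n) :
  enorm (a *: v) = `|a| * enorm v.
Proof.
rewrite /enorm -sqrtr_sqr -sqrtrM ?sqr_ge0// mulr_sumr.
by congr Num.sqrt; apply: eq_bigr => i _; rewrite mxE exprMn.
Qed.

Lemma sphere_radial_proj (R : realType) n (v : 'rV[R]_n) :
  v != 0 -> sphere n (radial_proj v).
Proof.
move=> v0; rewrite /sphere /= enormZ ger0_norm ?invr_ge0 ?sqrtr_ge0//.
by rewrite mulVf// enorm_eq0.
Qed.

Lemma sphere_measure_sphere (R : realType) n :
  sphere_measure n.+1 (sphere n.+1 : set 'rV[R]_n.+1) = 1%E.
Proof.
rewrite -[sphere _]setCK probability_setC; last first.
  by apply: measurableC; exact: measurable_sphere.
rewrite [X in (1 - X)%E](_ : _ = 0%E) ?sube0//.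
rewrite /= /sphere_measure [X in (_ * X)%E](_ : _ = 0%E) ?mule0//.
apply: (@subset_measure0 _ _ _ (lebesgue_row n.+1) _ (cube 0)).
- apply: measurableI; last exact: measurable_unit_ball.
  rewrite -[X in measurable X]setTI; apply: measurable_radial_proj => //.
  by apply: measurableC; exact: measurable_sphere.
- exact: measurable_cube.
- move=> v [/= Sv _] i; have [->|/sphere_radial_proj//] := eqVneq v 0.
  by rewrite mxE oppr0 bound_itvE.
- by have := @lebesgue_row_cube R n.+1 0 (lexx 0); rewrite mulr0 expr0n.
Qed.

Section sphere_calculus.
Context {R : realType} (n : nat).

Definition radial_ext (T : Type) (f : 'rV[R]_n -> T) : 'rV[R]_n -> T :=
  f \o @radial_proj R n.

Definition partial (F : 'rV[R]_n -> R) (j : 'I_n) (y : 'rV[R]_n) : R :=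
  'D_(delta_mx ord0 j) F y.

(* [f] is [C^1] on the sphere when its 0-homogeneous extension is [C^1] on the
   space minus the origin; the values of [f] off the sphere are irrelevant. *)
Definition sphere_C1 (f : 'rV[R]_n -> R) : Prop :=
  forall y, y != 0 -> differentiable (radial_ext f) y /\
    forall j, {for y, continuous (partial (radial_ext f) j)}.

Definition sphere_C1_complex (f : 'rV[R]_n -> R[i]) : Prop :=
  sphere_C1 (fun x => complex.Re (f x)) /\ sphere_C1 (fun x => complex.Im (f x)).

Definition sphere_grad (f : 'rV[R]_n -> R[i]) (x : 'rV[R]_n) : 'rV[R[i]]_n :=
  \row_j Complex (partial (radial_ext (fun y => complex.Re (f y))) j x)
                 (partial (radial_ext (fun y => complex.Im (f y))) j x).

(* At a zero of [f] both terms vanish, since [0^-1 = 0]. *)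
Definition phase_deriv (f : 'rV[R]_n -> R[i]) (x : 'rV[R]_n) : 'rV[R[i]]_n :=
  (2 * 'i%C * f x)^-1 *: sphere_grad f x
  - (2 * 'i%C * (f x)^*%C)^-1 *: sphere_grad (fun y => (f y)^*%C) x.

Lemma phase_derivE (f : 'rV[R]_n -> R[i]) (x : 'rV[R]_n) :
  sphere_C1_complex f -> x != 0 ->
  let u y := complex.Re (f y) in let v y := complex.Im (f y) in
  phase_deriv f x = \row_j ((u x * partial (radial_ext v) j x
    - v x * partial (radial_ext u) j x) / Normc.normc (f x) ^+ 2)%:C%C.
Proof.
move=> [_ vC1] x0 u v; apply/rowP => j; rewrite !mxE.
have -> : partial (radial_ext (fun y => complex.Re (f y)^*%C)) j x =
    partial (radial_ext u) j x.
  congr (partial (radial_ext _) j x); apply/funext => y.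
  by rewrite /u; case: (f y).
have -> : partial (radial_ext (fun y => complex.Im (f y)^*%C)) j x =
    - partial (radial_ext v) j x.
  have [dv _] := vC1 _ x0; rewrite /partial -deriveN; last exact/diff_derivable.
  congr ('D_ _ _ x); apply/funext => y.
  by rewrite /radial_ext /v /= /GRing.opp /=; case: (f _).
rewrite /u /v; case: (f x) => a b /=.
move: (partial _ _ _) (partial _ _ _) => q p.
rewrite sqr_sqrtr ?addr_ge0 ?sqr_ge0//.
have [ab0|ab0] := eqVneq (a ^+ 2 + b ^+ 2) 0.
  have [-> ->] : a = 0 /\ b = 0.
    move: ab0 => /eqP; rewrite paddr_eq0 ?sqr_ge0// !sqrf_eq0.
    by move=> /andP[/eqP-> /eqP->].
  rewrite oppr0 -[Complex 0 0]/(0 : R[i]) !mulr0 invr0 !mul0r subrr.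
  by rewrite expr0n/= addr0 invr0 mulr0.
pose F := Complex a b; pose G := Complex a (- b).
have FG : F * G = (a ^+ 2 + b ^+ 2)%:C%C.
  by apply/eqP; rewrite eq_complex /=; apply/andP; split; apply/eqP; ring.
have FG0 : F * G != 0.
  by rewrite FG -(rmorph0 (real_complex R)) (inj_eq (@complexI _)).
have [F0 G0] : F != 0 /\ G != 0 by move: FG0; rewrite mulf_eq0 negb_or => /andP.
have i0 : 'i%C != 0 :> R[i] by rewrite eq_complex /= oner_eq0 andbF.
have two0 : 2 != 0 :> R[i] by rewrite pnatr_eq0.
have c0 : 2 * 'i%C * (F * G) != 0 by rewrite !mulf_neq0.
apply: (mulfI c0); rewrite -/F -/G.
have wE : F * G * ((a * q - b * p) / (a ^+ 2 + b ^+ 2))%:C%C =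
    (a * q - b * p)%:C%C.
  rewrite FG; apply/eqP; rewrite eq_complex /=.
  by apply/andP; split; apply/eqP; field.
rewrite -[RHS]mulrA wE.
transitivity (G * Complex p q - F * Complex p (- q)).
  by field; rewrite F0 G0 i0.
rewrite -mulrA mulr_natl mulr2n.
by apply/eqP; rewrite eq_complex /=; apply/andP; split; apply/eqP; ring.
Qed.

Local Notation sigma := (@sphere_measure R n).
Local Notation S := (@sphere R n).

Definition mean_position (f : 'rV[R]_n -> R[i]) : 'rV[R]_n :=
  \row_j \int[sigma]_(x in S) (x ord0 j * Normc.normc (f x) ^+ 2).

Definition variance_position (f : 'rV[R]_n -> R[i]) : R :=
  \int[sigma]_(x in S)
    (enorm (x - mean_position f) ^+ 2 * Normc.normc (f x) ^+ 2).

Definition covariance_abs (f : 'rV[R]_n -> R[i]) : R :=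
  \int[sigma]_(x in S) (enorm (x - mean_position f) * hnorm (phase_deriv f x)
    * Normc.normc (f x) ^+ 2).

End sphere_calculus.

(* Main.v *)
Require Import Defs.
From mathcomp Require Import all_boot all_order all_algebra.
From mathcomp Require Import complex.
From mathcomp Require Import all_classical all_reals all_analysis.
From mathcomp Require Import measurable_realfun ring lra zify.

Import Order.TTheory GRing.Theory Num.Theory.
Import numFieldNormedType.Exports.

Local Open Scope classical_set_scope.
Local Open Scope ring_scope.

(** Write [f = u + i v], [rho = |f|^2], [tau] for the mean of [x] under the density
[rho], [t = |tau|], [V] for the variance and [I] for the integral of [|grad f|^2].
The product [conj f * grad f] splits into its real part [s], which is half the
gradient of [rho], and its imaginary part [w], which is [rho] times the phase
derivative; hence [|s|^2 + |w|^2 = rho |grad f|^2] ([current_half_grad_density]).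
The two terms on the small side of the inequality come from [s] and from [w].

- By definition the covariance [P] is the integral of [|x - tau| |w|].
- Let [e] be the direction of [tau]. Integration by parts on the sphere
  ([sphere_integral_partial]: the integral of the [j]-th component of the gradient
  of [g] is [n] times that of [x_j g]), applied to [rho], says that the integral
  [Q] of [e . s] is [n t / 2]. As [s] is tangent, only the tangential part of [e]
  counts: [(e . s)^2 <= (|e|^2 - (e . x)^2) |s|^2]. Projecting matters: with
  [tau - x] in place of the tangential part of [e] the same argument would give
  [t^4] instead of [t^2]. By convexity the mean of [|e|^2 - (e . x)^2] under [rho]
  is at most [1 - t^2], which is [V] ([tangential_sqnorm_le], [variance_density]).

For every [l > 0], Young's inequality applied pointwise to
[P |x - tau| |w| + Q (e . s)] and integrated gives
[2 l (P^2 + Q^2) <= l^2 I + V (P^2 + Q^2)], and optimizing over [l] gives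
[P^2 + Q^2 <= V I]. Treating [s] and [w] together is what yields the sum of the
two squares.

Integration by parts is derived from the flat fundamental theorem of calculus. The
measure of the sphere is the cone measure, so integrals over the sphere are, up to
a constant, integrals over the ball of functions constant along rays. If [H] is
homogeneous of degree [1] and [C^1] off the origin, the field [(1 - |y|^2m) H e_j]
vanishes on the sphere, so its [j]-th derivative integrates to [0] along each chord
of the ball that avoids the origin; by Fubini it integrates to [0] over the ball
([radial_divergence]). Expanding the derivative gives a relation between the
integrals over the ball weighted by [1] and by [|y|^2m]. The fields [y_j g], summed
over [j], compute the weighted integral of any [C^1] function [g]
([radial_moment_C1]), which replaces polar coordinates; the field [|y| g] then gives
the formula for the gradient when [m] tends to infinity
([partial_radial_moment]). *)

(** * Topology and measurability of row vectors *)

Section basics.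
Context {R : realType} {n : nat}.
Implicit Types (x y : 'rV[R]_n).

Definition sqnorm y : R := \sum_(i < n) y ord0 i ^+ 2.

Lemma sqnorm_ge0 y : 0 <= sqnorm y.
Proof. by apply: sumr_ge0 => i _; exact: sqr_ge0. Qed.

Lemma enorm_sqr y : enorm y ^+ 2 = sqnorm y.
Proof. by rewrite sqr_sqrtr// sqnorm_ge0. Qed.

Lemma enorm_ge0 y : 0 <= enorm y. Proof. exact: sqrtr_ge0. Qed.

Lemma enorm_gt0 y : (0 < enorm y) = (y != 0).
Proof. by rewrite lt_def enorm_ge0 andbT enorm_eq0. Qed.

Lemma sqnorm_gt0 y : (0 < sqnorm y) = (y != 0).
Proof. by rewrite -enorm_sqr exprn_even_gt0//= enorm_eq0. Qed.

Lemma sphere_neq0 {x} : sphere n x -> x != 0.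
Proof. by rewrite -enorm_eq0 => ->; exact: oner_neq0. Qed.

Lemma sqnorm_sphere {x} : sphere n x -> sqnorm x = 1.
Proof. by rewrite -enorm_sqr => ->; rewrite expr1n. Qed.

Lemma radial_proj_sphere {x} : sphere n x -> radial_proj x = x.
Proof. by rewrite /radial_proj => ->; rewrite invr1 scale1r. Qed.

Lemma radial_proj0 : radial_proj 0 = 0 :> 'rV[R]_n.
Proof. exact: scaler0. Qed.

Lemma radial_projK y : radial_proj (radial_proj y) = radial_proj y.
Proof.
have [->|y0] := eqVneq y 0; first by rewrite !radial_proj0.
exact/radial_proj_sphere/sphere_radial_proj.
Qed.

Lemma radial_projZ (a : R) y : 0 < a -> radial_proj (a *: y) = radial_proj y.
Proof.
move=> a0; rewrite /radial_proj enormZ gtr0_norm// scalerA invfM mulrAC.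
by rewrite mulVf ?mul1r// gt_eqF.
Qed.

Lemma radial_proj_eq0 y : (radial_proj y == 0) = (y == 0).
Proof.
by rewrite scaler_eq0 invr_eq0 enorm_eq0 orbb.
Qed.

Lemma continuous_row {T : topologicalType} (f : T -> 'rV[R]_n) (t : T) :
  (forall i, {for t, continuous (fun z => f z ord0 i)}) ->
  {for t, continuous f}.
Proof.
move=> fc; apply/cvg_ballP => e e0.
have H i : \forall z \near t, ball (f t ord0 i) e (f z ord0 i).
  by move/cvg_ballP : (fc i) => /(_ e e0).
near=> z; split=> // j i; rewrite (ord1 j); move: i; near: z.
by apply: filter_forall => i; exact: H.
Unshelve. all: by end_near. Qed.

Lemma sqnorm_continuous : continuous sqnorm.
Proof.
apply: continuous_big => [|i _ y]; first exact: add_continuous.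
by rewrite /GRing.exp/=; apply: continuousM; exact: coord_continuous.
Qed.

Lemma enorm_continuous : continuous (@enorm R n).
Proof.
move=> y; apply: (@continuous_comp _ _ _ sqnorm Num.sqrt).
  exact: sqnorm_continuous.
exact: sqrt_continuous.
Qed.

Lemma radial_proj_continuous y : y != 0 ->
  {for y, continuous (@radial_proj R n)}.
Proof.
move=> y0; apply: continuous_row => i.
rewrite (_ : (fun z => _) = (fun z => (enorm z)^-1 * z ord0 i)); last first.
  by apply/funext => z; rewrite mxE.
apply: continuousM; last exact: coord_continuous.
apply: continuousV; first by rewrite enorm_eq0.
exact: enorm_continuous.
Qed.

Lemma open_row_neq0 : open [set y : 'rV[R]_n | y != 0].
Proof.
rewrite [X in open X](_ : _ = ~` [set 0]); last first.
  by apply/seteqP; split => y /= /eqP.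
apply: closed_openC.
exact: accessible_closed_set1 (hausdorff_accessible (@norm_hausdorff _ _)) _.
Qed.

Lemma measurable_row_ball (x : 'rV[R]_n) (e : R) : 0 < e -> measurable (ball x e).
Proof.
move=> e0; rewrite [X in measurable X](_ : _ =
    \bigcap_(i : 'I_n) ((fun y => y ord0 i) @^-1` (ball (x ord0 i) e))); last first.
  apply/seteqP; split => y /=.
    by move=> [_ h] i _; exact: h.
  by move=> h; split => // j i; rewrite (ord1 j); exact: h.
apply: fin_bigcap_measurable => // i _.
rewrite -[X in measurable X]setTI; apply: measurable_row_coord => //.
exact: measurable_ball.
Qed.

(** Rational boxes form a countable base, and boxes belong to the product
sigma-algebra by construction. *)
Lemma open_measurable_row (U : set 'rV[R]_n) : open U -> measurable U.
Proof.
move=> oU.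
pose B (p : 'rV[rat]_n * nat) : set 'rV[R]_n :=
  ball (map_mx ratr p.1 : 'rV[R]_n) p.2.+1%:R^-1.
rewrite (_ : U = \bigcup_(p in [set p | B p `<=` U]) B p); last first.
  apply/seteqP; split => [y Uy|y [p pU]]; last exact: pU.
  have /nbhs_ballP[e /= e0 eU] : nbhs y U by exact: open_nbhs_nbhs.
  have [k ke] : exists k : nat, k.+1%:R^-1 < e / 2.
    have [k _ kP] := near_infty_natSinv_lt (PosNum (divr_gt0 e0 (ltr0n R 2))).
    by exists k; exact: (kP k (leqnn k)).
  have : 0 < k.+1%:R^-1 :> R by rewrite invr_gt0.
  move: ke; set d : R := k.+1%:R^-1 => de d0.
  have H (i : 'I_n) : exists q : rat, y ord0 i - d < ratr q < y ord0 i + d.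
    have [q] := @rat_in_itvoo R (y ord0 i - d) (y ord0 i + d) ltac:(lra).
    by rewrite in_itv/=; exists q.
  have [q qP] := choice H.
  exists (\row_i q i, k) => /=.
    move=> z /= zB; apply: eU; split=> // j i; rewrite (ord1 j).
    case: zB => _ /(_ ord0 i); rewrite !mxE /ball/= !ltr_distl -/d => /andP[z1 z2].
    by have /andP[q1 q2] := qP i; apply/andP; split; lra.
  split=> // j i; rewrite (ord1 j) !mxE /ball/= ltr_distl -/d.
  by have /andP[q1 q2] := qP i; apply/andP; split; lra.
rewrite bigcup_mkcond; apply: countable_bigcupT_measurable => [|p].
  exact: countableP.
by case: ifPn => // _; apply: measurable_row_ball; rewrite invr_gt0.
Qed.

(** At the origin [k] may be discontinuous, as extensions along rays are; a point
is measurable, so this does no harm. *)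
Lemma continuous_off0_measurable (k : 'rV[R]_n -> R) :
  (forall y, y != 0 -> {for y, continuous k}) -> measurable_fun setT k.
Proof.
move=> ck.
have m0 : measurable [set y : 'rV[R]_n | y != 0].
  by apply: open_measurable_row; exact: open_row_neq0.
rewrite -(setUv [set y : 'rV[R]_n | y != 0]); apply/measurable_funU => //.
  exact: measurableC.
have N0 y : (~` [set y : 'rV[R]_n | y != 0]) y <-> y = 0.
  by split=> [/negP/negPn/eqP|->] //=; rewrite eqxx.
split.
  move=> mD; apply: (measurability _ (RGenOInfty.measurableE R)).
  move=> _ [_ [x ->] <-].
  apply: open_measurable_row; rewrite openE => y [/= y0 ky].
  rewrite /interior; apply: filterI.
    by apply: open_nbhs_nbhs; split => //; exact: open_row_neq0.
  by apply: (ck y y0); apply: open_nbhs_nbhs; split => //; exact: interval_open.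
  exact: mD.
move=> mD Y mY; have [k0|k0] := pselect (Y (k 0)).
  rewrite (_ : _ `&` _ = ~` [set y | y != 0])//.
  by apply/seteqP; split=> [y []//|y y0]; split=> //; rewrite /= (N0 y).1.
rewrite (_ : _ `&` _ = set0)//.
by apply/seteqP; split=> // y [/N0 -> /=].
Qed.

(** * Continuous functions on the sphere *)

(** Continuity is asked of the extension along rays, like differentiability in
[sphere_C1], so that values off the sphere are irrelevant. *)
Definition sphere_continuous (k : 'rV[R]_n -> R) :=
  forall y, y != 0 -> {for y, continuous (radial_ext k)}.

Lemma sphere_continuous_cst (c : R) : sphere_continuous (cst c).
Proof. by move=> y _; exact: cst_continuous. Qed.

Lemma sphere_continuous_coord (i : 'I_n) :
  sphere_continuous (fun x => x ord0 i).
Proof.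
move=> y y0; apply: (@continuous_comp _ _ _ (@radial_proj R n) (fun x => x ord0 i)).
  exact: radial_proj_continuous.
exact: coord_continuous.
Qed.

Lemma sphere_continuousD k1 k2 : sphere_continuous k1 -> sphere_continuous k2 ->
  sphere_continuous (fun x => k1 x + k2 x).
Proof. by move=> c1 c2 y y0; apply: continuousD; [exact: c1|exact: c2]. Qed.

Lemma sphere_continuousM k1 k2 : sphere_continuous k1 -> sphere_continuous k2 ->
  sphere_continuous (fun x => k1 x * k2 x).
Proof. by move=> c1 c2 y y0; apply: continuousM; [exact: c1|exact: c2]. Qed.

Lemma sphere_continuousN k : sphere_continuous k ->
  sphere_continuous (fun x => - k x).
Proof. by move=> c y y0; apply: continuousN; exact: c. Qed.

Lemma sphere_continuousB k1 k2 : sphere_continuous k1 -> sphere_continuous k2 ->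
  sphere_continuous (fun x => k1 x - k2 x).
Proof. by move=> c1 c2; exact/sphere_continuousD/sphere_continuousN. Qed.

Lemma sphere_continuousX k m : sphere_continuous k ->
  sphere_continuous (fun x => k x ^+ m).
Proof.
move=> c; elim: m => [|m ih]; first exact: sphere_continuous_cst.
under eq_fun do rewrite exprS.
exact: sphere_continuousM.
Qed.

Lemma sphere_continuous_sum I (r : seq I) (k : I -> 'rV[R]_n -> R) :
  (forall i, sphere_continuous (k i)) ->
  sphere_continuous (fun x => \sum_(i <- r) k i x).
Proof.
move=> c; elim: r => [|i r ih].
  by under eq_fun do rewrite big_nil; exact: sphere_continuous_cst.
under eq_fun do rewrite big_cons.
exact: sphere_continuousD.
Qed.

Lemma sphere_continuous_sqrt k : sphere_continuous k ->
  sphere_continuous (fun x => Num.sqrt (k x)).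
Proof.
move=> c y y0; apply: (@continuous_comp _ _ _ (radial_ext k) Num.sqrt).
  exact: c.
exact: sqrt_continuous.
Qed.

Lemma sphere_continuous_measurable k : sphere_continuous k ->
  measurable_fun setT (radial_ext k).
Proof. exact: continuous_off0_measurable. Qed.

Lemma compact_sphere : compact (sphere n : set 'rV[R]_n).
Proof.
apply: bounded_closed_compact.
  exists 1; split => // M M1 x x1 /=.
  rewrite -[leLHS]/(mx_norm x) mx_normrE; apply: le_trans (ltW M1).
  apply/bigmax_leP; split => //= -[i j] _ /=; rewrite (ord1 i).
  rewrite -x1 -sqrtr_sqr ler_sqrt ?sqnorm_ge0// (bigD1 j)//= lerDl.
  by apply: sumr_ge0 => l _; exact: sqr_ge0.
have /continuous_closedP : continuous (@enorm R n) by exact: enorm_continuous.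
by move=> /(_ [set 1]); apply; exact: closed_eq.
Qed.

(** The extension takes its values on the compact sphere, except at the origin,
where its value is unrelated to the others; hence the maximum below. *)
Lemma sphere_continuous_bounded k : sphere_continuous k ->
  exists C, forall y, `|radial_ext k y| <= C.
Proof.
move=> c.
have [n0|[x0 Sx0]] : (sphere n : set 'rV[R]_n) = set0 \/ exists x : 'rV[R]_n, sphere n x.
    by have [->|/set0P] := eqVneq (sphere n : set 'rV[R]_n) set0; [left|right].
  exists (`|k 0|) => y; have [->|y0] := eqVneq y 0.
    by rewrite /radial_ext/= radial_proj0.
  by have := sphere_radial_proj y0; rewrite n0.
have [] := @EVT_max_rV R n (fun x => `|radial_ext k x|) (sphere n).
- by exists x0.
- exact: compact_sphere.
- apply: continuous_in_subspaceT => y; rewrite inE => Sy.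
  apply: continuous_comp; last exact: norm_continuous.
  exact/c/sphere_neq0.
move=> x Sx xmax.
exists (Num.max `|k 0| `|radial_ext k x|) => y; rewrite le_max.
have [->|y0] := eqVneq y 0; first by rewrite /radial_ext/= radial_proj0 lexx.
apply/orP; right.
have := xmax (radial_proj y).
rewrite /radial_ext/= radial_projK; apply.
by rewrite inE; exact: sphere_radial_proj.
Qed.

End basics.

(** * Integrals over the sphere as integrals over the ball *)

Section moments.
Context {R : realType} {n : nat}.
Implicit Types k : 'rV[R]_n -> R.

Local Notation lambda := (lebesgue_row n : {measure set 'rV[R]_n -> \bar R}).
Local Notation B := (unit_ball n : set 'rV[R]_n).

Lemma measurable_sqnorm : measurable_fun setT (@sqnorm R n).
Proof.
by apply: continuous_off0_measurable => y _; exact: sqnorm_continuous.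
Qed.

Lemma unit_ball_sqnorm (y : 'rV[R]_n) : unit_ball n y <-> sqnorm y <= 1.
Proof. by rewrite -enorm_sqr expr_le1 ?enorm_ge0. Qed.

(** For [m = 0] this is the integral of [k] over the sphere, up to normalization
([sphere_integralE]). *)
Definition radial_moment (m : nat) k : R :=
  \int[lambda]_(y in B) (sqnorm y ^+ m * radial_ext k y).

Lemma radial_moment_integrable m k : sphere_continuous k ->
  lambda.-integrable B (EFin \o (fun y => sqnorm y ^+ m * radial_ext k y)).
Proof.
move=> ck; apply: measurable_bounded_integrable.
- exact: measurable_unit_ball.
- exact: lebesgue_row_ball_lty.
- apply: measurable_funTS; apply: measurable_funM.
    by apply: measurable_funX; exact: measurable_sqnorm.
  exact: sphere_continuous_measurable.
- have [C kC] := sphere_continuous_bounded _ ck.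
  exists C; split; first exact: num_real.
  move=> M CM y /= By; apply: le_trans (ltW CM).
  rewrite normrM -[leRHS]mul1r ler_pM//.
  rewrite ger0_norm ?exprn_ge0 ?sqnorm_ge0//.
  by rewrite exprn_ile1 ?sqnorm_ge0//; exact/unit_ball_sqnorm.
Qed.

Lemma radial_momentD m k1 k2 : sphere_continuous k1 -> sphere_continuous k2 ->
  radial_moment m (fun x => k1 x + k2 x) = radial_moment m k1 + radial_moment m k2.
Proof.
move=> c1 c2; rewrite /radial_moment -RintegralD.
- by apply: eq_Rintegral => y _; rewrite -mulrDr.
- exact: measurable_unit_ball.
- exact: radial_moment_integrable.
- exact: radial_moment_integrable.
Qed.

Lemma radial_momentZ m c k : sphere_continuous k ->
  radial_moment m (fun x => c * k x) = c * radial_moment m k.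
Proof.
move=> ck; rewrite /radial_moment -RintegralZl.
- by apply: eq_Rintegral => y _; rewrite mulrCA.
- exact: measurable_unit_ball.
- exact: radial_moment_integrable.
Qed.

Lemma radial_moment_sum m I (r : seq I) (k : I -> 'rV[R]_n -> R) :
  (forall i, sphere_continuous (k i)) ->
  radial_moment m (fun x => \sum_(i <- r) k i x) =
    \sum_(i <- r) radial_moment m (k i).
Proof.
move=> ck; elim: r => [|i r ih].
  rewrite big_nil; transitivity (radial_moment m (fun x => 0 * cst 0 x)).
    by congr radial_moment; apply/funext => x; rewrite big_nil mul0r.
  by rewrite radial_momentZ ?mul0r//; exact: sphere_continuous_cst.
rewrite big_cons -ih -radial_momentD//; last exact: sphere_continuous_sum.
by congr radial_moment; apply/funext => x; rewrite big_cons.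
Qed.

Lemma le_normr_radial_moment m k C : sphere_continuous k ->
  (forall y, `|radial_ext k y| <= C) ->
  `|radial_moment m k| <= C * radial_moment m (cst 1).
Proof.
move=> ck kC.
have mB := @measurable_unit_ball R n.
rewrite -radial_momentZ; last exact: sphere_continuous_cst.
apply: le_trans (le_normr_Rintegral mB (radial_moment_integrable m k ck)) _.
apply: le_Rintegral => //.
- have := integrable_norm (radial_moment_integrable m k ck).
  exact.
- apply: radial_moment_integrable.
  by apply: sphere_continuousM; exact: sphere_continuous_cst.
- move=> y By; rewrite /radial_ext/= mulr1 normrM.
  rewrite ger0_norm ?exprn_ge0 ?sqnorm_ge0//.
  by rewrite ler_wpM2l ?exprn_ge0 ?sqnorm_ge0//; exact: kC.
Qed.

End moments.

Lemma ge0_integral_mrestr d (T : measurableType d) (R : realType)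
    (mu : {measure set T -> \bar R}) (D : set T) (mD : measurable D)
    (h : T -> \bar R) : measurable_fun setT h -> (forall x, (0 <= h x)%E) ->
  (\int[mrestr mu mD]_x h x = \int[mu]_(x in D) h x)%E.
Proof.
move=> mh h0.
have D0 : mrestr mu mD (~` D) = 0%E by rewrite /mrestr setICl measure0.
rewrite (ge0_negligible_integral (measurableC mD) measurableT mh)//.
rewrite (_ : setT `\` ~` D = D); last by rewrite -setTD setDD setTI.
by apply: eq_measure_integral => A mA AD; rewrite /= /mrestr setIidl.
Qed.

Section sphere_integral.
Context {R : realType} {n : nat}.
Implicit Types k : 'rV[R]_n.+1 -> R.

Local Notation lambda := (lebesgue_row n.+1 : {measure set 'rV[R]_n.+1 -> \bar R}).
Local Notation B := (unit_ball n.+1 : set 'rV[R]_n.+1).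
Local Notation sigma := (@sphere_measure R n.+1).
Local Notation S := (@sphere R n.+1).

(** The cone measure is the image under the radial projection of the normalized
Lebesgue measure of the ball. *)
Lemma ge0_integral_sphere_measure (h : 'rV[R]_n.+1 -> \bar R) :
  measurable_fun setT h -> (forall x, (0 <= h x)%E) ->
  (\int[sigma]_x h x =
   ((fine (lambda B))^-1)%:E * \int[lambda]_(y in B) h (radial_proj y))%E.
Proof.
move=> mh h0.
have c0 : 0 <= (fine (lambda B))^-1 by rewrite invr_ge0 fine_ge0.
have mB := @measurable_unit_ball R n.+1.
rewrite (eq_measure_integral (pushforward (mscale (NngNum c0) (mrestr lambda mB))
   (@radial_proj R n.+1))); last by [].
have mp := @measurable_radial_proj R n.+1.
have mhp : measurable_fun setT (h \o @radial_proj R n.+1).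
  exact: measurableT_comp.
rewrite ge0_integral_pushforward// preimage_setT.
rewrite ge0_integral_mscale//; last by move=> x _; exact: h0.
congr (_ * _)%E.
by rewrite ge0_integral_mrestr// => x; exact: h0.
Qed.

Lemma sphere_continuous_integrable k : sphere_continuous k ->
  sigma.-integrable S (EFin \o k).
Proof.
move=> ck; apply: (@eq_integrable _ _ _ _ _ _ (EFin \o radial_ext k)).
- exact: measurable_sphere.
- by move=> x; rewrite inE => Sx; rewrite /radial_ext/= radial_proj_sphere.
apply: measurable_bounded_integrable.
- exact: measurable_sphere.
- have s1 : sigma S = 1%E by exact: sphere_measure_sphere.
  have : (sigma S < +oo)%E by rewrite s1 ltry.
  exact.
- by apply: measurable_funTS; exact: sphere_continuous_measurable.
- have [C kC] := sphere_continuous_bounded _ ck.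
  exists C; split; first exact: num_real.
  by move=> M CM y /= By; apply: le_trans (ltW CM).
Qed.

Lemma ge0_sphere_integralE k : sphere_continuous k ->
  (forall y, 0 <= radial_ext k y) ->
  \int[sigma]_(x in S) k x = (fine (lambda B))^-1 * radial_moment 0 k.
Proof.
move=> ck k0.
have mk : measurable_fun setT (EFin \o radial_ext k).
  by apply/measurable_EFinP; exact: sphere_continuous_measurable.
have mS := @measurable_sphere R n.+1.
have sC : sigma (~` S) = 0%E.
  have h := @probability_setC _ _ _ sigma _ mS.
  have s1 : sigma S = 1%E by exact: sphere_measure_sphere.
  by apply: (etrans h); transitivity (1 - sigma S)%E => //; rewrite s1 subee.
have intk := radial_moment_integrable 0 k ck.
rewrite /Rintegral (_ : (\int[sigma]_(x in S) (k x)%:E =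
  \int[sigma]_x (EFin \o radial_ext k) x)%E); last first.
  rewrite (ge0_negligible_integral (measurableC mS) measurableT mk)//; last first.
    by move=> x _; rewrite lee_fin.
  rewrite (_ : setT `\` ~` S = S); last by rewrite -setTD setDD setTI.
  apply: eq_integral => x; rewrite inE => Sx.
  by rewrite /radial_ext/= radial_proj_sphere.
rewrite ge0_integral_sphere_measure//.
have -> : (\int[lambda]_(y in B) (EFin \o radial_ext k) (radial_proj y) =
    (radial_moment 0 k)%:E)%E.
  rewrite /radial_moment /Rintegral fineK; last first.
    by apply: integrable_fin_num => //; exact: measurable_unit_ball.
  by apply: eq_integral => y _; rewrite /radial_ext/= radial_projK expr0 mul1r.
by [].
Qed.

Lemma sphere_integralE k : sphere_continuous k ->
  \int[sigma]_(x in S) k x = (fine (lambda B))^-1 * radial_moment 0 k.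
Proof.
move=> ck; have [C kC] := sphere_continuous_bounded _ ck.
have cC : sphere_continuous (cst C : 'rV[R]_n.+1 -> R).
  exact: sphere_continuous_cst.
have C0 : 0 <= C by apply: le_trans (kC 0); exact: normr_ge0.
(* shifting by a bound reduces to the nonnegative case *)
have ckC := sphere_continuousD _ _ ck cC.
have mS := @measurable_sphere R n.+1.
have h := ge0_sphere_integralE _ ckC.
rewrite radial_momentD// RintegralD// in h; last 2 first.
  exact: sphere_continuous_integrable.
  exact: sphere_continuous_integrable.
rewrite (ge0_sphere_integralE _ cC) in h; last by [].
apply: (addIr ((fine (lambda B))^-1 * radial_moment 0 (cst C))).
rewrite -mulrDr; apply: h => y.
by have := kC y; rewrite ler_norml /radial_ext/= => /andP[h1 _]; lra.
Qed.

End sphere_integral.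

(** * Integration along the lines of a coordinate direction *)

Lemma integrable_bounded_support d (T : measurableType d) (R : realType)
    (mu : {measure set T -> \bar R}) (D : set T) (h : T -> R) (C : R) :
  measurable D -> (mu D < +oo)%E -> measurable_fun setT h ->
  (forall x, `|h x| <= C) -> (forall x, ~ D x -> h x = 0) ->
  mu.-integrable setT (EFin \o h).
Proof.
move=> mD Doo mh hC h0.
rewrite (_ : EFin \o h = (EFin \o h) \_ D); last first.
  apply/funext => x; rewrite patchE; case: ifPn => //= xD.
  by rewrite h0// => Dx; move: xD; rewrite mem_set.
apply/(integrable_mkcond _ mD).
apply: measurable_bounded_integrable => //; first exact: measurable_funTS.
exists C; split; first exact: num_real.
by move=> M CM x /= _; exact: le_trans (ltW CM).
Qed.

Definition set_coord {R : realType} {n} (j : 'I_n) (t : R) (v : 'rV[R]_n) : 'rV[R]_n :=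
  \row_i if i == j then t else v ord0 i.

Lemma set_coord_row_cons0 (R : realType) n (t s : R) (w : 'rV[R]_n) :
  set_coord ord0 t (row_cons (s, w)) = row_cons (t, w).
Proof.
apply/rowP => i; rewrite !mxE; case: (unliftP ord0 i) => [j|] ->.
  by rewrite eq_sym (negbTE (neq_lift _ _)).
by rewrite eqxx.
Qed.

Lemma set_coord_row_cons (R : realType) n (j : 'I_n) (t s : R) (w : 'rV[R]_n) :
  set_coord (lift ord0 j) t (row_cons (s, w)) = row_cons (s, set_coord j t w).
Proof.
apply/rowP => i; rewrite !mxE; case: (unliftP ord0 i) => [k|] ->.
  by rewrite (inj_eq (@lift_inj _ ord0)) !mxE.
by rewrite (negbTE (neq_lift _ _)).
Qed.

Section lines.
Context {R : realType}.

Lemma integral_row_succ n (F : 'rV[R]_n.+1 -> R) (C : R) :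
  measurable_fun setT F -> (forall y, `|F y| <= C) ->
  (forall y, ~ cube 1 y -> F y = 0) ->
  (\int[lebesgue_row n.+1]_y (F y)%:E =
    \int[lebesgue_measure \x lebesgue_row n]_p (F (row_cons p))%:E)%E
  /\ (lebesgue_measure \x lebesgue_row n)%E.-integrable setT
       (fun p => (F (row_cons p))%:E).
Proof.
move=> mF FC F0.
have mcons := @measurable_row_cons R n.
have Fint : (lebesgue_measure \x lebesgue_row n)%E.-integrable setT
    (EFin \o (F \o @row_cons R n)).
  apply: (@integrable_bounded_support _ _ _ _ (@row_cons R n @^-1` cube 1) _ C) => //.
  - rewrite -[X in measurable X]setTI; apply: mcons => //; exact: measurable_cube.
  - have := @lebesgue_row_cube R n.+1 1 ler01.
    rewrite /= /lebesgue_row_succ /pushforward => ->.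
    exact: ltry.
  - exact: measurableT_comp.
  - by move=> p; exact: FC.
  - by move=> p /= h; exact: F0.
split => //.
rewrite [LHS](_ : _ = \int[pushforward (lebesgue_measure \x lebesgue_row n) (@row_cons R n)]_y (F y)%:E)%E//.
rewrite integral_pushforward ?preimage_setT//.
exact/measurable_EFinP.
Qed.

(** Fubini in an arbitrary coordinate direction. The measure is an iterated product
starting with coordinate [0], so other directions are reached by induction on the
dimension: fixing coordinate [0] leaves a function of the same kind. *)
Lemma integral_lines0 n (j : 'I_n) (F : 'rV[R]_n -> R) (C : R) :
  measurable_fun setT F -> (forall y, `|F y| <= C) ->
  (forall y, ~ cube 1 y -> F y = 0) ->
  (forall v, \int[lebesgue_measure]_t (F (set_coord j t v))%:E = 0)%E ->
  (\int[lebesgue_row n]_y (F y)%:E = 0)%E.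
Proof.
elim: n j F => [[]//|n ih] j F mF FC F0 line0.
have [-> Fint] := integral_row_succ n F C mF FC F0.
case: (unliftP ord0 j) line0 => [i|] -> line0.
- rewrite -integral12_prod_meas1//=.
  rewrite integral0_eq// => s _.
  rewrite /fubini_F; apply: (ih i (fun w => F (row_cons (s, w)))).
  + exact: (measurableT_comp mF (measurableT_comp (@measurable_row_cons R n) (pair1_measurable s))).
  + by move=> y; exact: FC.
  + move=> y ny; apply: F0 => cy; apply: ny => k.
    by have := cy (lift ord0 k); rewrite mxE liftK.
  + move=> v; rewrite -[RHS](line0 (row_cons (s, v))).
    by apply: eq_integral => t _; rewrite set_coord_row_cons.
- rewrite -integral21_prod_meas1//=.
  rewrite integral0_eq// => w _.
  rewrite /fubini_G -[RHS](line0 (row_cons (0, w))).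
  by apply: eq_integral => t _; rewrite set_coord_row_cons0.
Qed.

(** This allows for functions that are singular at the origin: lines in direction
[j] through the origin lie in the hyperplane [y_k = 0]. That hyperplane does not
contribute, because it meets each line in direction [k] in a single point. *)
Lemma integral_lines0_off n (j k : 'I_n) (F : 'rV[R]_n -> R) (C : R) : k != j ->
  measurable_fun setT F -> (forall y, `|F y| <= C) ->
  (forall y, ~ cube 1 y -> F y = 0) ->
  (forall v : 'rV[R]_n, (v ord0 k != 0)%R ->
    \int[lebesgue_measure]_t (F (set_coord j t v))%:E = 0)%E ->
  (\int[lebesgue_row n]_y (F y)%:E = 0)%E.
Proof.
move=> kj mF FC F0 line0.
pose H : set 'rV[R]_n := [set y | y ord0 k = 0].
have mH : measurable H.
  rewrite -[X in measurable X]setTI.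
  exact: (measurable_row_coord k measurableT (measurable_set1 (0 : R))).
have C0 : 0 <= C by apply: le_trans (FC 0); exact: normr_ge0.
have FD (D : set 'rV[R]_n) : measurable D ->
    [/\ measurable_fun setT (F \_ D), forall y, `|(F \_ D) y| <= C &
     forall y, ~ cube 1 y -> (F \_ D) y = 0].
  move=> mD; split.
  - apply/(measurable_restrictT _ mD); exact: measurable_funTS.
  - by move=> y; rewrite patchE; case: ifP => // _; rewrite normr0.
  - by move=> y cy; rewrite patchE; case: ifP => // _; exact: F0.
have Fint D : measurable D -> (lebesgue_row n).-integrable setT (EFin \o (F \_ D)).
  move=> mD; have [m1 m2 m3] := FD D mD.
  apply: (@integrable_bounded_support _ _ _ _ (cube 1) _ C) => //.
  - exact: measurable_cube.
  - have : (lebesgue_row n (cube 1 : set 'rV[R]_n) < +oo)%E.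
      by rewrite lebesgue_row_cube// ltry.
    exact.
have FE y : (F y)%:E = ((F \_ H) y)%:E + ((F \_ (~` H)) y)%:E :> \bar R.
  rewrite -EFinD !patchE; congr EFin.
  by rewrite in_setC; case: (y \in H); rewrite /= ?addr0 ?add0r.
under eq_integral do rewrite FE.
rewrite integralD//; [|exact: Fint|exact/Fint/measurableC].
rewrite [X in (X + _)%E](_ : _ = 0%E); last first.
  have [m1 m2 m3] := FD H mH.
  apply: (integral_lines0 _ k _ C m1 m2 m3) => v.
  transitivity (\int[@lebesgue_measure R]_(t in [set 0%R])
      (F (set_coord k t v))%:E)%E; last by rewrite integral_set1.
  rewrite [RHS]integral_mkcond.
  apply: eq_integral => t _; rewrite !patchE; case: ifPn => [|tH].
    by rewrite inE /H/= mxE eqxx => ->; rewrite ifT// inE.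
  case: ifPn => //; rewrite inE/= => t0; case/negP: tH.
  by rewrite inE /H/= mxE eqxx.
have [m1 m2 m3] := FD _ (measurableC mH).
rewrite add0e; apply: (integral_lines0 _ j _ C m1 m2 m3) => v.
have [vk|vk] := eqVneq (v ord0 k) 0.
  rewrite integral0_eq// => t _; rewrite patchE ifF//.
  apply/negP; rewrite inE; apply.
  by rewrite /H/= mxE (negbTE kj).
rewrite -[RHS](line0 v vk); apply: eq_integral => t _.
rewrite patchE ifT// inE /H/= mxE (negbTE kj); exact/eqP.
Qed.

End lines.

(** * The divergence theorem for radially weighted fields on the ball *)

Lemma is_derive_expn {R : numFieldType} {V : normedModType R} (f : V -> R) m
    (x v : V) (df : R) : is_derive x v f df ->
  is_derive x v (fun y => f y ^+ m) (m%:R * f x ^+ m.-1 * df).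
Proof. by move=> /(@is_deriveX _ _ f m x v df); rewrite exprfctE. Qed.

Lemma is_derive_cstDsqr {R : realType} (s t : R) :
  is_derive t 1 (fun t : R => s + t ^+ 2) (2 * t).
Proof.
apply: (is_derive_eq (is_deriveD (is_derive_cst s t 1)
  (is_derive_expn _ 2 _ _ _ (is_derive_id t 1)))).
by rewrite add0r expr1 mulr1.
Qed.

Section chord.
Context {R : realType} {n : nat}.
Implicit Types (v y : 'rV[R]_n) (j : 'I_n).

Lemma set_coordE j t h v :
  set_coord j (h + t) v = h *: delta_mx ord0 j + set_coord j t v.
Proof.
apply/rowP => i; rewrite !mxE eqxx/=; case: eqVneq => _.
  by rewrite mulr1.
by rewrite mulr0 add0r.
Qed.

Lemma set_coord_continuous j v : continuous (fun t => set_coord j t v).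
Proof.
move=> t; apply: continuous_row => i.
rewrite (_ : (fun z => _) = (fun z => if i == j then z else v ord0 i)); last first.
  by apply/funext => z; rewrite mxE.
by case: eqVneq => _; [exact: cvg_id|exact: cvg_cst].
Qed.

Lemma set_coord_neq0 j k t v : k != j -> v ord0 k != 0 -> set_coord j t v != 0.
Proof.
move=> kj; apply: contraNneq => /rowP /(_ k).
by rewrite !mxE (negbTE kj) => ->.
Qed.

Definition sqnorm_off j v : R := \sum_(i < n | i != j) v ord0 i ^+ 2.

Lemma sqnorm_set_coord j t v :
  sqnorm (set_coord j t v) = sqnorm_off j v + t ^+ 2.
Proof.
rewrite /sqnorm (bigD1 j)//= mxE eqxx addrC; congr (_ + _).
by apply: eq_bigr => i ij; rewrite mxE (negbTE ij).
Qed.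

Lemma is_derive_line (H : 'rV[R]_n -> R) j t v (dH : R) :
  is_derive (set_coord j t v) (delta_mx ord0 j) H dH ->
  is_derive t 1 (fun t => H (set_coord j t v)) dH.
Proof.
move=> [dvH DH].
have E : (fun h : R => h^-1 *: (H (set_coord j (h *: 1 + t) v) - H (set_coord j t v))) =
  (fun h => h^-1 *: (H (h *: delta_mx ord0 j + set_coord j t v) - H (set_coord j t v))).
  by apply/funext => h; rewrite set_coordE [h *: 1]mulr1.
by split; rewrite /derivable /derive/= /shift/= ?E.
Qed.

(** The integrand is the derivative along [e_j] of [(1 - |y|^2m) H], where
[|y|^2 k2] stands for [y_j H]. This function vanishes at both ends of the chord,
and [v_k <> 0] keeps the line away from the origin. *)
Lemma integral_chord j k (H k1 k2 : 'rV[R]_n -> R) (m : nat) v :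
  k != j -> v ord0 k != 0 -> (0 < m)%N ->
  sphere_continuous k1 -> sphere_continuous k2 ->
  (forall y, y != 0 -> is_derive y (delta_mx ord0 j) H (radial_ext k1 y)) ->
  (forall y, y != 0 -> y ord0 j * H y = sqnorm y * radial_ext k2 y) ->
  (\int[@lebesgue_measure R]_t
    (((fun y => (1 - sqnorm y ^+ m) * radial_ext k1 y -
      (2 * m)%:R * (sqnorm y ^+ m * radial_ext k2 y)) \_ (@unit_ball R n))
     (set_coord j t v))%:E = 0)%E.
Proof.
move=> kj vk m0 c1 c2 dH jH.
pose s := sqnorm_off j v.
pose g (y : 'rV[R]_n) : R := (1 - sqnorm y ^+ m) * radial_ext k1 y -
      (2 * m)%:R * (sqnorm y ^+ m * radial_ext k2 y).
pose L t := set_coord j t v.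
have L0 t : L t != 0 by exact: set_coord_neq0 kj vk.
pose phi (t : R) : R := (1 - (s + t ^+ 2) ^+ m) * H (L t).
have dphi (t : R) : is_derive t 1 phi (g (L t)).
  have dHL := is_derive_line _ _ _ _ _ (dH _ (L0 t)).
  have da : is_derive t 1 (fun t : R => 1 - (s + t ^+ 2) ^+ m)
      (- (m%:R * (s + t ^+ 2) ^+ m.-1 * (2 * t))).
    apply: (is_derive_eq (is_deriveB (is_derive_cst (1 : R) t 1)
      (is_derive_expn _ m _ _ _ (is_derive_cstDsqr s t)))).
    by rewrite sub0r.
  apply: (is_derive_eq (is_deriveM da dHL)).
  have jHt := jH _ (L0 t); rewrite mxE eqxx in jHt.
  rewrite /g sqnorm_set_coord -/s -/(L t).
  have -> : (s + t ^+ 2) ^+ m = (s + t ^+ 2) * (s + t ^+ 2) ^+ m.-1.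
    by rewrite -exprS prednK.
  rewrite sqnorm_set_coord -/s -/(L t) in jHt.
  rewrite natrM /GRing.scale/=; move: (_ ^+ m.-1) => P; move: jHt.
  move: (H _) (radial_ext k1 _) (radial_ext k2 _) => h a b jHt.
  rewrite [h * _](_ : _ = - (2 * m%:R * P * (t * h))); last by ring.
  by rewrite jHt; ring.
have gc : continuous (fun t => g (L t)).
  move=> u.
  have sc : {for u, continuous (fun t => sqnorm (L t) ^+ m)}.
    apply: (@continuous_comp _ _ _ (fun t => sqnorm (L t)) (fun x => x ^+ m)).
      apply: (@continuous_comp _ _ _ L (@sqnorm R n)).
        exact: set_coord_continuous.
      exact: sqnorm_continuous.
    exact: exprn_continuous.
  have kc k' : sphere_continuous k' -> {for u, continuous (fun t => radial_ext k' (L t))}.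
    move=> ck'; apply: (@continuous_comp _ _ _ L (radial_ext k')).
      exact: set_coord_continuous.
    exact: ck'.
  apply: cvgB; apply: cvgM.
  - by apply: cvgB => //; exact: cvg_cst.
  - exact: kc.
  - exact: cvg_cst.
  - by apply: cvgM => //; exact: kc.
have [s1|s1] := ltP 1 s.
  rewrite integral0_eq// => t _; rewrite patchE ifF//.
  apply/negP; rewrite inE unit_ball_sqnorm sqnorm_set_coord -/s => st.
  by have := sqr_ge0 t; lra.
(* the line meets the ball in the parameters of absolute value at most [r] *)
pose r := Num.sqrt (1 - s).
have r2 : r ^+ 2 = 1 - s by rewrite sqr_sqrtr ?subr_ge0.
have BE t : (set_coord j t v \in @unit_ball R n) = (t \in `[- r, r]).
  rewrite in_itv/= -ler_norml; apply/idP/idP => [|tr].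
    rewrite inE unit_ball_sqnorm sqnorm_set_coord -/s => st.
    rewrite -sqrtr_sqr ler_wsqrtr//; lra.
  rewrite inE unit_ball_sqnorm sqnorm_set_coord -/s.
  have : `|t| ^+ 2 <= r ^+ 2 by rewrite lerXn2r ?nnegrE ?sqrtr_ge0.
  by rewrite real_normK ?num_real// r2; lra.
pose I : set R := [set` `[- r, r]].
transitivity (\int[@lebesgue_measure R]_(t in I) (g (L t))%:E)%E.
  rewrite [RHS]integral_mkcond; apply: eq_integral => t _.
  rewrite !patchE BE (_ : (t \in I) = (t \in `[- r, r])) /=; last first.
    by apply/idP/idP => [/set_mem //|tI]; exact/mem_set.
  by case: ifP.
have : 0 <= r by exact: sqrtr_ge0.
rewrite le_eqVlt => /predU1P[r0|r0].
  by rewrite /I -r0 oppr0 set_itv1 integral_set1.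
have phir : phi r = 0 by rewrite /phi r2 subrKC expr1n subrr mul0r.
have phiNr : phi (- r) = 0 by rewrite /phi sqrrN r2 subrKC expr1n subrr mul0r.
have dphiE (t : R) : derivable phi t 1 by case: (dphi t).
have cphi : continuous phi.
  by move=> t; apply/differentiable_continuous/derivable1_diffP.
rewrite (@continuous_FTC2 _ (g \o L) phi).
- by rewrite phir phiNr subee.
- by rewrite gtrN.
- exact: continuous_subspaceT.
- split; first by move=> t _; exact: dphiE.
  + by apply: cvg_at_right_filter; exact: cphi.
  + by apply: cvg_at_left_filter; exact: cphi.
- by move=> t _; rewrite derive1E; case: (dphi t).
Qed.

End chord.

Section divergence.
Context {R : realType} {n : nat}.

Lemma unit_ball_cube (y : 'rV[R]_n) : unit_ball n y -> cube 1 y.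
Proof.
move=> y1 i; rewrite in_itv/= -ler_norml -sqrtr_sqr (le_trans _ y1)//.
by rewrite ler_wsqrtr// (bigD1 i)//= lerDl sumr_ge0// => l _; exact: sqr_ge0.
Qed.

(** The chord identity integrated over all chords in direction [j]. The functions
[k1] and [k2] represent, along rays, the derivative of [H] and [y_j H / |y|^2]; this
is how homogeneity of degree [1] of [H] enters. *)
Lemma radial_divergence (j k : 'I_n) (H k1 k2 : 'rV[R]_n -> R) (m : nat) :
  k != j -> (0 < m)%N ->
  sphere_continuous k1 -> sphere_continuous k2 ->
  (forall y : 'rV[R]_n, y != 0 -> is_derive y (delta_mx ord0 j) H (radial_ext k1 y)) ->
  (forall y : 'rV[R]_n, y != 0 -> y ord0 j * H y = sqnorm y * radial_ext k2 y) ->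
  radial_moment 0 k1 - radial_moment m k1 = (2 * m)%:R * radial_moment m k2.
Proof.
move=> kj m0 c1 c2 dH jH.
pose g (y : 'rV[R]_n) : R := (1 - sqnorm y ^+ m) * radial_ext k1 y -
      (2 * m)%:R * (sqnorm y ^+ m * radial_ext k2 y).
have mB := @measurable_unit_ball R n.
have [C1 k1C] := sphere_continuous_bounded _ c1.
have [C2 k2C] := sphere_continuous_bounded _ c2.
have mg : measurable_fun setT g.
  have mX : measurable_fun setT (fun y : 'rV[R]_n => sqnorm y ^+ m).
    by apply: measurable_funX; exact: measurable_sqnorm.
  apply: measurable_funB; apply: measurable_funM => //.
  - exact: measurable_funB.
  - exact: sphere_continuous_measurable.
  - by apply: measurable_funM => //; exact: sphere_continuous_measurable.
have gC y : `|(g \_ (@unit_ball R n)) y| <= C1 + (2 * m)%:R * C2.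
  have C10 : 0 <= C1 by apply: le_trans (k1C 0); exact: normr_ge0.
  have C20 : 0 <= C2 by apply: le_trans (k2C 0); exact: normr_ge0.
  rewrite patchE; case: ifPn => [|_]; last by rewrite normr0 addr_ge0 ?mulr_ge0.
  rewrite inE => /unit_ball_sqnorm y1.
  have Xm : 0 <= sqnorm y ^+ m <= 1.
    by rewrite exprn_ge0 ?sqnorm_ge0//= exprn_ile1 ?sqnorm_ge0.
  rewrite (le_trans (ler_normB _ _))// lerD// !normrM.
    rewrite -[leRHS]mul1r ler_pM// ger0_norm; lra.
  rewrite ger0_norm// ler_wpM2l// -[leRHS]mul1r ler_pM// ger0_norm; lra.
have g0 y : ~ cube 1 y -> (g \_ (@unit_ball R n)) y = 0.
  move=> cy; rewrite patchE ifF//; apply/negP; rewrite inE => By.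
  exact/cy/unit_ball_cube.
have int0 : (\int[lebesgue_row n]_y ((g \_ (@unit_ball R n)) y)%:E = 0)%E.
  apply: (integral_lines0_off _ j k _ _ kj _ gC g0) => [|v vk].
    apply/(measurable_restrictT _ mB); exact: measurable_funTS.
  exact: (integral_chord _ _ _ _ _ _ _ kj vk m0 c1 c2 dH jH).
have int0' : \int[lebesgue_row n]_(y in @unit_ball R n) g y = 0.
  by rewrite Rintegral_mkcond /Rintegral int0.
have Hi := @radial_moment_integrable R n.
move/eqP: int0'; rewrite (_ : g = fun y => (sqnorm y ^+ 0 * radial_ext k1 y -
    sqnorm y ^+ m * radial_ext k1 y) -
    (2 * m)%:R * (sqnorm y ^+ m * radial_ext k2 y)); last first.
  by apply/funext => y; rewrite /g expr0 mulrBl.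
rewrite RintegralB//; last 2 first.
- exact: (integrableB mB (Hi 0%N _ c1) (Hi m _ c1)).
- exact: (integrableZl mB _ (Hi m _ c2)).
rewrite RintegralB//; [|exact: Hi|exact: Hi].
rewrite RintegralZl//; last exact: Hi.
by rewrite subr_eq0 => /eqP.
Qed.

End divergence.

(** * Calculus of functions extended along rays *)

Section sphere_C1.
Context {R : realType} {n : nat}.
Implicit Types (x y : 'rV[R]_n) (j : 'I_n) (g : 'rV[R]_n -> R).

Lemma set_coord_id j y : set_coord j (y ord0 j) y = y.
Proof. by apply/rowP => i; rewrite mxE; case: eqVneq => // ->. Qed.

Lemma is_derive_of_line (H : 'rV[R]_n -> R) j y (dH : R) :
  is_derive (y ord0 j) 1 (fun t : R => H (set_coord j t y)) dH ->
  is_derive y (delta_mx ord0 j) H dH.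
Proof.
move=> [dvH DH].
have E : (fun h : R => h^-1 *: (H (set_coord j (h *: 1 + y ord0 j) y) -
    H (set_coord j (y ord0 j) y))) =
  (fun h => h^-1 *: (H (h *: delta_mx ord0 j + y) - H y)).
  by apply/funext => h; rewrite set_coordE [h *: 1]mulr1 set_coord_id.
by split; rewrite /derivable /derive/= /shift/= -?E.
Qed.

Lemma is_derive_coord j i y :
  is_derive y (delta_mx ord0 j) (fun y => y ord0 i) ((i == j)%:R : R).
Proof.
apply: is_derive_of_line.
under eq_fun do rewrite mxE.
by case: eqVneq => _; [exact: is_derive_id|exact: is_derive_cst].
Qed.

Lemma is_derive_enorm j y : y != 0 ->
  is_derive y (delta_mx ord0 j) (@enorm R n) (y ord0 j / enorm y).
Proof.
move=> y0; apply: is_derive_of_line.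
pose s := sqnorm_off j y; set t := y ord0 j.
have sE : s + t ^+ 2 = sqnorm y by rewrite -(set_coord_id j y) sqnorm_set_coord.
rewrite (_ : (fun _ => _) = Num.sqrt \o (fun t : R => s + t ^+ 2)); last first.
  by apply/funext => z /=; rewrite -sqnorm_set_coord.
have s0 : 0 < s + t ^+ 2 by rewrite sE sqnorm_gt0.
have ds : is_derive (s + t ^+ 2) 1 (@Num.sqrt R) (2 * Num.sqrt (s + t ^+ 2))^-1.
  exact: is_derive1_sqrt.
apply: (is_derive_eq (@is_derive1_comp _ _ (fun t : R => s + t ^+ 2) t _ _ ds
  (is_derive_cstDsqr s t))).
rewrite sE -[Num.sqrt (sqnorm y)]/(enorm y).
by field; rewrite enorm_eq0.
Qed.

Lemma differentiable_enorm y : y != 0 -> differentiable (@enorm R n) y.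
Proof.
move=> y0.
apply: (@differentiable_comp _ _ _ _ (@sqnorm R n) Num.sqrt).
  rewrite (_ : @sqnorm R n = \sum_(i < n) ((fun y => y ord0 i) ^+ 2)); last first.
    apply/funext => z; rewrite fct_sumE; apply: eq_bigr => i _.
    by rewrite exprfctE.
  by apply: differentiable_sum => i; apply: differentiableX; exact: differentiable_coord.
have s0 : 0 < sqnorm y by rewrite sqnorm_gt0.
by apply/derivable1_diffP; case: (is_derive1_sqrt s0).
Qed.

Lemma continuous_off0_eq (f g : 'rV[R]_n -> R) :
  (forall y, y != 0 -> f y = g y) ->
  (forall y, y != 0 -> {for y, continuous g}) ->
  forall y, y != 0 -> {for y, continuous f}.
Proof.
move=> fg cg y y0.
have nz : nbhs y [set z | z != 0].
  by apply: open_nbhs_nbhs; split => //; exact: open_row_neq0.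
move=> A fA; have := cg y y0 A; rewrite /= -fg// => /(_ fA) gA.
by apply: filterS2 nz gA => z z0 /=; rewrite -fg.
Qed.

Lemma sphere_C1_continuous g : sphere_C1 g -> sphere_continuous g.
Proof. by move=> gC y /gC[dg _]; exact: differentiable_continuous. Qed.

Lemma sphere_C1_partial g j : sphere_C1 g ->
  sphere_continuous (partial (radial_ext g) j).
Proof.
move=> gC y y0; apply: (@continuous_comp _ _ _ (@radial_proj R n)).
  exact: radial_proj_continuous.
by have [] := gC (radial_proj y); rewrite ?radial_proj_eq0.
Qed.

Lemma sphere_C1_is_derive g j y : sphere_C1 g -> y != 0 ->
  is_derive y (delta_mx ord0 j) (radial_ext g) (partial (radial_ext g) j y).
Proof.
by move=> gC y0; apply: derivableP; apply: diff_derivable; case: (gC y y0).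
Qed.

Lemma sphere_C1_cst (c : R) : sphere_C1 (cst c : 'rV[R]_n -> R).
Proof.
move=> y y0; split; first exact: differentiable_cst.
move=> j; rewrite (_ : partial _ _ = cst 0); first exact: cst_continuous.
by apply/funext => z; rewrite /partial derive_cst.
Qed.

Lemma partialD f g j y : sphere_C1 f -> sphere_C1 g -> y != 0 ->
  partial (radial_ext (fun x => f x + g x)) j y =
  partial (radial_ext f) j y + partial (radial_ext g) j y.
Proof.
move=> fC gC y0; apply: derive_val.
by apply: is_deriveD; exact: sphere_C1_is_derive.
Qed.

Lemma partialM f g j y : sphere_C1 f -> sphere_C1 g -> y != 0 ->
  partial (radial_ext (fun x => f x * g x)) j y =
  radial_ext f y * partial (radial_ext g) j y +
  radial_ext g y * partial (radial_ext f) j y.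
Proof.
move=> fC gC y0; apply: derive_val.
by apply: is_deriveM; exact: sphere_C1_is_derive.
Qed.

Lemma sphere_C1D f g : sphere_C1 f -> sphere_C1 g ->
  sphere_C1 (fun x => f x + g x).
Proof.
move=> fC gC y y0; split.
  by apply: differentiableD; [case: (fC y y0)|case: (gC y y0)].
move=> j; move: y y0; apply: continuous_off0_eq => [y y0|].
  exact: partialD.
by move=> y y0; apply: continuousD; [case: (fC y y0)|case: (gC y y0)].
Qed.

Lemma sphere_C1M f g : sphere_C1 f -> sphere_C1 g ->
  sphere_C1 (fun x => f x * g x).
Proof.
move=> fC gC y y0; split.
  by apply: differentiableM; [case: (fC y y0)|case: (gC y y0)].
move=> j; move: y y0; apply: continuous_off0_eq => [y y0|].
  exact: partialM.
move=> y y0; apply: continuousD; apply: continuousM.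
- exact: sphere_C1_continuous.
- by case: (gC y y0).
- exact: sphere_C1_continuous.
- by case: (fC y y0).
Qed.

Lemma sphere_C1_coord i : sphere_C1 (fun x => x ord0 i).
Proof.
have E : radial_ext (fun x : 'rV[R]_n => x ord0 i) = (fun y => (enorm y)^-1 * y ord0 i).
  by apply/funext => y; rewrite /radial_ext/= mxE.
move=> y y0; split.
  rewrite E; apply: differentiableM; last exact: differentiable_coord.
  by apply: differentiableV; [exact: differentiable_enorm|rewrite enorm_eq0].
move=> j; move: y y0; apply: (@continuous_off0_eq _
  (fun y => (enorm y)^-1 * (i == j)%:R + y ord0 i * (- (enorm y) ^- 2 * (y ord0 j / enorm y)))).
  move=> y y0; rewrite /partial E; apply: derive_val.
  apply: is_deriveM.
    have [de <-] := is_derive_enorm j _ y0.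
    have e0 : enorm y != 0 by rewrite enorm_eq0.
    by split; [exact: derivableV|rewrite deriveV].
  exact: is_derive_coord.
move=> y y0.
have cV : {for y, continuous (fun y : 'rV[R]_n => (enorm y)^-1)}.
  by apply: continuousV; [rewrite enorm_eq0|exact: enorm_continuous].
have cc k : {for y, continuous (fun y : 'rV[R]_n => y ord0 k)}.
  exact: coord_continuous.
rewrite [X in {for _, continuous X}](_ : _ = fun y => (enorm y)^-1 * (i == j)%:R -
    y ord0 i * ((enorm y)^-1 * (enorm y)^-1 * (y ord0 j * (enorm y)^-1))); last first.
  by apply/funext => z; rewrite mulNr mulrN expr2 invfM.
apply: continuousB; first by apply: continuousM => //; exact: cst_continuous.
by do ! apply: continuousM.
Qed.

Lemma radial_extZ (T : Type) (f : 'rV[R]_n -> T) (a : R) y :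
  0 < a -> radial_ext f (a *: y) = radial_ext f y.
Proof. by move=> a0; rewrite /radial_ext/= radial_projZ. Qed.

(** The derivative of a function constant along rays is homogeneous of degree
[-1]. *)
Lemma partialZ g j (a : R) y : sphere_C1 g -> y != 0 -> 0 < a ->
  partial (radial_ext g) j (a *: y) = a^-1 * partial (radial_ext g) j y.
Proof.
move=> gC y0 a0.
have ay0 : a *: y != 0 by rewrite scaler_eq0 gt_eqF.
have aE t : a *: set_coord j t y = set_coord j (a * t) (a *: y).
  by apply/rowP => i; rewrite !mxE; case: eqVneq.
have dray : is_derive (a * y ord0 j) 1
    (fun t => radial_ext g (set_coord j t (a *: y))) (partial (radial_ext g) j (a *: y)).
  by apply: is_derive_line; rewrite -aE set_coord_id; exact: sphere_C1_is_derive.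
have da : is_derive (y ord0 j) 1 (fun t => a * t) a.
  have H := @is_deriveZ _ _ _ (@id R) a (y ord0 j) 1 1 (is_derive_id (y ord0 j) 1).
  by apply: (is_derive_eq H); rewrite [a *: 1]mulr1.
have := is_derive1_comp dray da.
rewrite (_ : _ \o _ = fun t => radial_ext g (set_coord j t y)); last first.
  by apply/funext => t /=; rewrite -aE radial_extZ.
move=> /is_derive_of_line[_]; rewrite -/(partial _ _ _) => ->.
by rewrite mulrC mulfK// gt_eqF.
Qed.

(** Euler's relation in degree [0]: the gradient on the sphere is tangent. *)
Lemma euler_partial g y : sphere_C1 g ->
  \sum_(j < n) y ord0 j * partial (radial_ext g) j y = 0.
Proof.
move=> gC; have [->|y0] := eqVneq y 0.
  by rewrite big1// => j _; rewrite mxE mul0r.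
have [dg _] := gC _ y0.
transitivity ('D_y (radial_ext g) y).
  rewrite deriveE// [in RHS](_ : 'd (radial_ext g) y y =
      'd (radial_ext g) y (\sum_(j < n) y ord0 j *: delta_mx ord0 j)); last first.
    by rewrite -row_sum_delta.
  rewrite linear_sum; apply: eq_bigr => j _.
  by rewrite linearZ /partial deriveE.
rewrite /derive; apply: cvg_lim => //; apply: cvg_near_cst.
have /(nbhs_dnbhs (x := 0 : R)) : nbhs (0 : R) [set h : R | `|h| < 1].
  by move: (@nbhsx_ballx _ R 0 1 ltr01); apply: filterS => h; rewrite /ball/= sub0r normrN.
apply: filterS => h h1.
rewrite /= -[X in _ *: y + X]scale1r -scalerDl radial_extZ.
  by rewrite subrr scaler0.
by move: h1; rewrite /= ltr_norml => /andP[h1 _]; lra.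
Qed.

End sphere_C1.

(** * Integration by parts on the sphere *)

Section spherical_ibp.
Context {R : realType} {n : nat} (n_gt1 : (1 < n)%N).
Implicit Types (x y : 'rV[R]_n) (j : 'I_n) (g : 'rV[R]_n -> R).

Lemma exists_neq_ord j : exists k : 'I_n, k != j.
Proof.
have [j0|j0] := eqVneq (val j) 0%N.
  by exists (Ordinal n_gt1); rewrite -val_eqE/= j0.
by exists (Ordinal (ltnW n_gt1)); rewrite -val_eqE/= eq_sym.
Qed.

Lemma eq_radial_moment m (k1 k2 : 'rV[R]_n -> R) : (0 < m)%N ->
  (forall x, sphere n x -> k1 x = k2 x) ->
  radial_moment m k1 = radial_moment m k2.
Proof.
move=> m0 k12; apply: eq_Rintegral => y _.
have [->|y0] := eqVneq y 0.
  rewrite (_ : sqnorm 0 = 0) ?expr0n ?gtn_eqF ?mul0r//.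
  by rewrite /sqnorm big1// => i _; rewrite mxE expr0n.
by congr (_ * _); apply: k12; exact: sphere_radial_proj.
Qed.

(** The field [y g], cut off by [1 - |y|^2m], has divergence [n g (1 - |y|^2m)] up
to the term coming from the cut-off, since the gradient of [g] is tangent. The
conclusion says that the weight [|y|^2m] multiplies integrals by [n / (n + 2 m)], as
polar coordinates would show. *)
Lemma radial_moment_C1 m g : (0 < m)%N -> sphere_C1 g ->
  n%:R * (radial_moment 0 g - radial_moment m g) =
  (2 * m)%:R * radial_moment m g.
Proof.
move=> m0 gC.
pose k1 (j : 'I_n) := fun x : 'rV[R]_n => g x + x ord0 j * partial (radial_ext g) j x.
pose k2 (j : 'I_n) := fun x : 'rV[R]_n => x ord0 j ^+ 2 * g x.
have gc := sphere_C1_continuous _ gC.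
have c1 j : sphere_continuous (k1 j).
  apply: sphere_continuousD => //; apply: sphere_continuousM.
    exact: sphere_continuous_coord.
  exact: sphere_C1_partial.
have c2 j : sphere_continuous (k2 j).
  apply: sphere_continuousM => //; apply: sphere_continuousX.
  exact: sphere_continuous_coord.
have div j : radial_moment 0 (k1 j) - radial_moment m (k1 j) =
    (2 * m)%:R * radial_moment m (k2 j).
  have [i ij] := exists_neq_ord j.
  apply: (@radial_divergence _ _ j i (fun y => y ord0 j * radial_ext g y)) => //.
    move=> y y0.
    apply: (is_derive_eq (is_deriveM (is_derive_coord j j y) (sphere_C1_is_derive _ j _ gC y0))).
    have ey : 0 < (enorm y)^-1 by rewrite invr_gt0 enorm_gt0.
    rewrite eqxx /radial_ext/= /k1 {4}/radial_proj mxE.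
    rewrite [partial _ j (radial_proj y)]partialZ// invrK.
    rewrite /GRing.scale/= /radial_ext/=.
    by field; rewrite enorm_eq0.
  move=> y y0; rewrite /radial_ext/= /k2 {2}/radial_proj mxE -enorm_sqr.
  by field; rewrite enorm_eq0.
have sum_k1 : (fun x => \sum_(j < n) k1 j x) = (fun x => n%:R * g x).
  apply/funext => x; rewrite big_split/= sumr_const card_ord euler_partial// addr0.
  by rewrite mulr_natl.
have sum_k2 x : sphere n x -> \sum_(j < n) k2 j x = g x.
  by move=> Sx; rewrite -mulr_suml -[X in X * _]/(sqnorm x) sqnorm_sphere// mul1r.
rewrite -[in RHS](eq_radial_moment _ _ _ m0 sum_k2) radial_moment_sum//.
rewrite mulrBr -[X in X - _]radial_momentZ// -[X in _ - X]radial_momentZ//.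
rewrite -sum_k1 !radial_moment_sum// -sumrB mulr_sumr.
by apply: eq_bigr => j _; exact: div.
Qed.

(** The field [|y| g e_j] relates the integral of the gradient to that of [x_j g],
up to a term weighted by [|y|^2m]. The gradient is merely continuous, so that term
is not computed but bounded by a multiple of the weighted volume, which tends to [0]
as [m] grows. *)
Lemma partial_radial_moment j g : sphere_C1 g ->
  radial_moment 0 (partial (radial_ext g) j) =
  (n%:R - 1) * radial_moment 0 (fun x => x ord0 j * g x).
Proof.
move=> gC.
pose k2 := fun x : 'rV[R]_n => x ord0 j * g x.
pose k1 := fun x : 'rV[R]_n => k2 x + partial (radial_ext g) j x.
have k2C : sphere_C1 k2 by apply: sphere_C1M => //; exact: sphere_C1_coord.
have c2 := sphere_C1_continuous _ k2C.
have cp : sphere_continuous (partial (radial_ext g) j) by exact: sphere_C1_partial.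
have c1 : sphere_continuous k1 by exact: sphere_continuousD.
have div m : (0 < m)%N -> radial_moment 0 k1 - radial_moment m k1 =
    (2 * m)%:R * radial_moment m k2.
  have [i ij] := exists_neq_ord j.
  move=> m0.
  apply: (@radial_divergence _ _ j i (fun y => enorm y * radial_ext g y)) => //.
    move=> y y0.
    apply: (is_derive_eq (is_deriveM (is_derive_enorm j _ y0) (sphere_C1_is_derive _ j _ gC y0))).
    have ey : 0 < (enorm y)^-1 by rewrite invr_gt0 enorm_gt0.
    rewrite /radial_ext/= /k1 /k2 {4}/radial_proj mxE.
    rewrite [partial _ j (radial_proj y)]partialZ// invrK.
    rewrite /GRing.scale/= /radial_ext/=.
    by field; rewrite enorm_eq0.
  move=> y y0; rewrite /radial_ext/= /k2 {2}/radial_proj mxE -enorm_sqr.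
  by field; rewrite enorm_eq0.
have [C k1C] := sphere_continuous_bounded _ c1.
have n0 : 0 < n%:R :> R by rewrite ltr0n ltnW.
pose V := radial_moment 0 (cst 1 : 'rV[R]_n -> R).
have mom m g' : (0 < m)%N -> sphere_C1 g' ->
    (n%:R + (2 * m)%:R) * radial_moment m g' = n%:R * radial_moment 0 g'.
  by move=> m0 g'C; have := radial_moment_C1 _ _ m0 g'C; lra.
pose D := radial_moment 0 k1 - n%:R * radial_moment 0 k2.
have DE m : (0 < m)%N -> (n%:R + (2 * m)%:R) * `|D| <=
    n%:R * (C * V + n%:R * `|radial_moment 0 k2|).
  move=> m0.
  have h1 := div m m0; have h2 := mom m _ m0 k2C.
  have h3 := mom m _ m0 (sphere_C1_cst 1); rewrite -/V in h3.
  have h4 := le_normr_radial_moment m _ _ c1 k1C.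
  set c := n%:R + (2 * m)%:R in h2 h3 *.
  have c0 : 0 < c by rewrite ltr_pwDl.
  have -> : c * `|D| = `|c * radial_moment m k1 - n%:R * (n%:R * radial_moment 0 k2)|.
    rewrite -{1}(gtr0_norm c0) -normrM; congr `|_|.
    rewrite /D (_ : radial_moment 0 k1 = radial_moment m k1 + (2 * m)%:R * radial_moment m k2); last by lra.
    have -> : (2 * m)%:R = c - n%:R by rewrite /c addrC addKr.
    by rewrite -h2; ring.
  apply: le_trans (ler_normB _ _) _.
  rewrite !normrM (gtr0_norm c0) (gtr0_norm n0) mulrDr lerD//.
  rewrite mulrCA -h3 mulrCA ler_pM2l//; exact: h4.
(* the bound on [(n + 2 m) |D|] does not depend on [m] *)
suff D0 : D = 0.
  move/eqP: D0; rewrite subr_eq0 /k1 radial_momentD// => /eqP h.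
  by rewrite mulrBl mul1r -h addrC addKr.
apply/eqP; rewrite -normr_eq0; apply/negPn/negP => D0.
have {}D0 : 0 < `|D| by rewrite lt_def D0 normr_ge0.
set K := n%:R * _ in DE.
have K0 : 0 <= K.
  by apply: le_trans (DE 1%N isT); rewrite mulr_ge0// addr_ge0// ltW.
have := DE (Num.bound (K / `|D|)).+1 isT.
have := archi_boundP (divr_ge0 K0 (ltW D0)); rewrite ltr_pdivrMr//.
move: (Num.bound _) => b Kb; apply/negP; rewrite -ltNge.
apply: (lt_le_trans Kb); rewrite ler_pM2r//.
by rewrite -natrD ler_nat; lia.
Qed.

End spherical_ibp.

(** Equivalently, the tangential part of the constant field [e_j] has divergence
[- n x_j] on the sphere of dimension [n]. *)
Lemma sphere_integral_partial (R : realType) n (j : 'I_n.+1)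
    (g : 'rV[R]_n.+1 -> R) : (0 < n)%N -> sphere_C1 g ->
  \int[sphere_measure n.+1]_(x in sphere n.+1) partial (radial_ext g) j x =
  n%:R * \int[sphere_measure n.+1]_(x in sphere n.+1) (x ord0 j * g x).
Proof.
move=> n0 gC; rewrite !sphere_integralE.
- by rewrite partial_radial_moment// mulrCA -natr1 addrK.
- apply: sphere_continuousM; first exact: sphere_continuous_coord.
  exact: sphere_C1_continuous.
- exact: sphere_C1_partial.
Qed.

(** * Elementary inequalities *)

Lemma cauchy_schwarz_sum (R : realFieldType) n (a b : 'I_n -> R) :
  (\sum_i a i * b i) ^+ 2 <= (\sum_i a i ^+ 2) * (\sum_i b i ^+ 2).
Proof.
set A := \sum_i a i ^+ 2; set B := \sum_i b i ^+ 2; set C := \sum_i a i * b i.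
have A0 : 0 <= A by apply: sumr_ge0 => i _; exact: sqr_ge0.
have : 0 <= \sum_i (A * b i - C * a i) ^+ 2.
  by apply: sumr_ge0 => i _; exact: sqr_ge0.
have -> : \sum_i (A * b i - C * a i) ^+ 2 = A * (A * B - C ^+ 2).
  transitivity (\sum_i (A ^+ 2 * b i ^+ 2 + (C ^+ 2 * a i ^+ 2 - 2 * A * C * (a i * b i)))).
    by apply: eq_bigr => i _; ring.
  rewrite big_split/= sumrB -!mulr_sumr -/A -/B -/C; ring.
move: A0; rewrite le_eqVlt => /predU1P[A0 _|A0]; last by rewrite pmulr_rge0// subr_ge0.
have a0 i : a i = 0.
  apply/eqP; rewrite -sqrf_eq0; move/esym/eqP: A0; rewrite psumr_eq0 => [|k _].
    by move=> /allP/(_ i); rewrite mem_index_enum; apply.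
  exact: sqr_ge0.
by rewrite /C big1 ?expr0n ?mulr_ge0//= ?sumr_ge0// => i _; rewrite ?sqr_ge0// a0 mul0r.
Qed.

(** Optimization over [l]: the choice [l = V] is the best one when equality holds,
and when [V = 0] it suffices that [l] be small compared with [K / I]. *)
Lemma le_of_quadratic (R : realFieldType) (K V I : R) : 0 <= V -> 0 <= I -> 0 <= K ->
  (forall l, 0 < l -> 2 * l * K <= l ^+ 2 * I + V * K) -> K <= V * I.
Proof.
move=> V0 I0 K0 h; move: V0; rewrite le_eqVlt => /predU1P[V0|V0].
  rewrite -V0 mul0r leNgt; apply/negP => Kp.
  have I1 : 0 < I + 1 by lra.
  pose l := K / (I + 1); have l0 : 0 < l by exact: divr_gt0.
  have KE : K = l * (I + 1) by rewrite /l divfK// gt_eqF.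
  have := h l l0; rewrite -V0 mul0r addr0 {1}KE => hl.
  have := mulr_gt0 (mulr_gt0 l0 l0) (ltr_pwDr (ltr0n R 2) I0); lra.
have := h V V0.
rewrite (_ : 2 * V * K = V * K + V * K); last by ring.
by rewrite lerD2r expr2 -mulrA ler_pM2l.
Qed.

(** When [r > 0] the difference of the two sides, multiplied by [r], is a square in
[w] plus a quadratic form in [l] and [Q] whose discriminant is the last hypothesis.
Stating it without division by [r] covers the zeros of the density, where [w] and
[s] vanish. *)
Lemma weighted_young (R : realFieldType) (l P Q a w s b r S A : R) :
  0 <= r -> 0 <= S -> 0 <= A -> 0 <= b ->
  w ^+ 2 + S = r * A -> s ^+ 2 <= b * S ->
  2 * l * (P * (a * w) + Q * s) <=
    l ^+ 2 * A + (P ^+ 2 * (a ^+ 2 * r) + Q ^+ 2 * (b * r)).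
Proof.
move=> r0 S0 A0 b0 wSA sbS.
have w20 := sqr_ge0 w; have s20 := sqr_ge0 s.
move: r0; rewrite le_eqVlt => /predU1P[r0|r0].
  rewrite -r0 mul0r in wSA.
  have S00 : S = 0 by lra.
  have w0 : w = 0 by apply/eqP; rewrite -sqrf_eq0; apply/eqP; lra.
  rewrite S00 mulr0 in sbS.
  have s0 : s = 0 by apply/eqP; rewrite -sqrf_eq0 eq_le sbS.
  by rewrite w0 s0 -r0 !(mulr0, addr0) mulr_ge0 ?sqr_ge0.
rewrite -subr_ge0 -(pmulr_rge0 _ r0).
rewrite (_ : r * _ = (l * w - P * a * r) ^+ 2 +
  (l ^+ 2 * S - 2 * l * Q * s * r + Q ^+ 2 * b * r ^+ 2)); last first.
  have -> : S = r * A - w ^+ 2 by lra.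
  ring.
rewrite addr_ge0 ?sqr_ge0//.
move: S0; rewrite le_eqVlt => /predU1P[S0|S0].
  rewrite -S0 mulr0 in sbS.
  have s0 : s = 0 by apply/eqP; rewrite -sqrf_eq0 eq_le sbS.
  rewrite s0 -S0 (_ : _ + _ = Q ^+ 2 * b * r ^+ 2); last by ring.
  by rewrite mulr_ge0 ?sqr_ge0// mulr_ge0 ?sqr_ge0.
rewrite -(pmulr_rge0 _ S0); apply: le_trans (sqr_ge0 (l * S - Q * r * s)) _.
rewrite -subr_ge0 (_ : _ - _ = (Q * r) ^+ 2 * (b * S - s ^+ 2)); last by ring.
by rewrite mulr_ge0 ?sqr_ge0 ?subr_ge0.
Qed.

(** * The uncertainty inequality for a pair of real functions *)

Section integral_calculus.
Context {R : realType} {n : nat}.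
Implicit Types k : 'rV[R]_n.+1 -> R.

Local Notation E k := (\int[@sphere_measure R n.+1]_(x in sphere n.+1) k x).
Let mS := @measurable_sphere R n.+1.

Lemma sphere_integralD k1 k2 : sphere_continuous k1 -> sphere_continuous k2 ->
  E (fun x => k1 x + k2 x) = E k1 + E k2.
Proof. by move=> c1 c2; rewrite RintegralD//; exact: sphere_continuous_integrable. Qed.

Lemma sphere_integralB k1 k2 : sphere_continuous k1 -> sphere_continuous k2 ->
  E (fun x => k1 x - k2 x) = E k1 - E k2.
Proof. by move=> c1 c2; rewrite RintegralB//; exact: sphere_continuous_integrable. Qed.

Lemma sphere_integralZ c k : sphere_continuous k ->
  E (fun x => c * k x) = c * E k.
Proof. by move=> ck; rewrite RintegralZl//; exact: sphere_continuous_integrable. Qed.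

Lemma sphere_integral_sum I (r : seq I) (k : I -> 'rV[R]_n.+1 -> R) :
  (forall i, sphere_continuous (k i)) ->
  E (fun x => \sum_(i <- r) k i x) = \sum_(i <- r) E (k i).
Proof.
move=> ck; rewrite sphere_integralE; last exact: sphere_continuous_sum.
rewrite radial_moment_sum// mulr_sumr; apply: eq_bigr => i _.
by rewrite sphere_integralE.
Qed.

Lemma eq_sphere_integral k1 k2 : (forall x, sphere n.+1 x -> k1 x = k2 x) ->
  E k1 = E k2.
Proof. by move=> k12; apply: eq_Rintegral => x; rewrite inE => /k12. Qed.

Lemma le_sphere_integral k1 k2 : sphere_continuous k1 -> sphere_continuous k2 ->
  (forall x, sphere n.+1 x -> k1 x <= k2 x) -> E k1 <= E k2.
Proof.
by move=> c1 c2 k12; apply: le_Rintegral => //; exact: sphere_continuous_integrable.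
Qed.

End integral_calculus.

Section uncertainty.
Context {R : realType} {n : nat} (n_gt0 : (0 < n)%N).
Context (u v : 'rV[R]_n.+1 -> R) (uC : sphere_C1 u) (vC : sphere_C1 v).

Local Notation E k := (\int[@sphere_measure R n.+1]_(x in sphere n.+1) k x).
Local Notation du := (partial (radial_ext u)).
Local Notation dv := (partial (radial_ext v)).

Definition density (x : 'rV[R]_n.+1) : R := u x ^+ 2 + v x ^+ 2.
Definition grad_sqnorm (x : 'rV[R]_n.+1) : R := \sum_j (du j x ^+ 2 + dv j x ^+ 2).
(** The imaginary part of [conj f * grad f] for [f = u + i v]: the probability
current of quantum mechanics. *)
Definition current j (x : 'rV[R]_n.+1) : R := u x * dv j x - v x * du j x.
Definition half_grad_density j (x : 'rV[R]_n.+1) : R := u x * du j x + v x * dv j x.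

Local Notation W x := (\sum_j current j x ^+ 2).
Local Notation Sg x := (\sum_j half_grad_density j x ^+ 2).

Let uc : sphere_continuous u. Proof. exact: sphere_C1_continuous. Qed.
Let vc : sphere_continuous v. Proof. exact: sphere_C1_continuous. Qed.
Let duc j : sphere_continuous (du j). Proof. exact: sphere_C1_partial. Qed.
Let dvc j : sphere_continuous (dv j). Proof. exact: sphere_C1_partial. Qed.

Lemma density_ge0 x : 0 <= density x.
Proof. by rewrite addr_ge0 ?sqr_ge0. Qed.

Lemma density_C1 : sphere_C1 density.
Proof.
rewrite /density; under eq_fun do rewrite !expr2.
by apply: sphere_C1D; exact: sphere_C1M.
Qed.

Let rc : sphere_continuous density. Proof. exact/sphere_C1_continuous/density_C1. Qed.

Lemma grad_sqnorm_continuous : sphere_continuous grad_sqnorm.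
Proof.
apply: sphere_continuous_sum => j.
by apply: sphere_continuousD; exact: sphere_continuousX.
Qed.

Lemma current_continuous j : sphere_continuous (current j).
Proof. by apply: sphere_continuousB; exact: sphere_continuousM. Qed.

Lemma half_grad_density_continuous j : sphere_continuous (half_grad_density j).
Proof. by apply: sphere_continuousD; exact: sphere_continuousM. Qed.

Lemma partial_density j x : sphere n.+1 x ->
  partial (radial_ext density) j x = 2 * half_grad_density j x.
Proof.
move=> Sx; have x0 := sphere_neq0 Sx.
rewrite (_ : density = fun x : 'rV[R]_n.+1 => u x * u x + v x * v x); last first.
  by apply/funext => z; rewrite /density !expr2.
rewrite partialD//; [|exact: sphere_C1M|exact: sphere_C1M].
rewrite !partialM// /half_grad_density /radial_ext/= radial_proj_sphere//.
ring.
Qed.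

(** Both sides are [|conj f * grad f|^2], on the left split into imaginary and real
parts. *)
Lemma current_half_grad_density x :
  W x + Sg x = density x * grad_sqnorm x.
Proof.
rewrite -big_split mulr_sumr; apply: eq_bigr => j _ /=.
rewrite /current /half_grad_density /density; ring.
Qed.

(** Cauchy-Schwarz with the tangential part of [e], whose squared norm is the factor
on the right. *)
Lemma half_grad_density_tangent (e x : 'rV[R]_n.+1) : sphere n.+1 x ->
  (\sum_j e ord0 j * half_grad_density j x) ^+ 2 <=
  (sqnorm e - (\sum_j e ord0 j * x ord0 j) ^+ 2) * Sg x.
Proof.
move=> Sx; set c := \sum_j e ord0 j * x ord0 j.
have tangent : \sum_j x ord0 j * half_grad_density j x = 0.
  transitivity (u x * \sum_j x ord0 j * du j x + v x * \sum_j x ord0 j * dv j x).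
    rewrite !mulr_sumr -big_split; apply: eq_bigr => j _ /=.
    by rewrite /half_grad_density; ring.
  by rewrite !euler_partial// !mulr0 addr0.
have -> : \sum_j e ord0 j * half_grad_density j x =
    \sum_j (e ord0 j - c * x ord0 j) * half_grad_density j x.
  under [RHS]eq_bigr do rewrite mulrBl -mulrA.
  by rewrite sumrB -mulr_sumr tangent mulr0 subr0.
apply: le_trans (cauchy_schwarz_sum _ _ _ _) _.
rewrite le_eqVlt; apply/orP; left; apply/eqP; congr (_ * _).
transitivity (\sum_j (e ord0 j ^+ 2 - (2 * c * (e ord0 j * x ord0 j) - c ^+ 2 * x ord0 j ^+ 2))).
  by apply: eq_bigr => j _; ring.
rewrite sumrB sumrB -!mulr_sumr -/c -[X in _ - (_ - _ * X)]/(sqnorm x) sqnorm_sphere//.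
by rewrite /sqnorm; ring.
Qed.

Context (r1 : E density = 1).
Definition mean_density : 'rV[R]_n.+1 := \row_j E (fun x : 'rV[R]_n.+1 => x ord0 j * density x).
Local Notation tau := mean_density.
Local Notation t := (enorm tau).
(* a unit vector, or [0] when [tau] vanishes; both cases are used uniformly *)
Let e := t^-1 *: tau.

Let coordc j : sphere_continuous (fun x : 'rV[R]_n.+1 => x ord0 j * density x).
Proof. by apply: sphere_continuousM => //; exact: sphere_continuous_coord. Qed.

Lemma sphere_integral_coord_density (c : 'I_n.+1 -> R) :
  E (fun x : 'rV[R]_n.+1 => \sum_j c j * (x ord0 j * density x)) = \sum_j c j * tau ord0 j.
Proof.
rewrite sphere_integral_sum => [|j]; last first.
  by apply: sphere_continuousM => //; exact: sphere_continuous_cst.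
by apply: eq_bigr => j _; rewrite sphere_integralZ// mxE.
Qed.

Lemma mean_direction : \sum_j e ord0 j * tau ord0 j = t.
Proof.
under eq_bigr do rewrite mxE -mulrA -expr2.
rewrite -mulr_sumr -[X in _ * X]/(sqnorm tau) -enorm_sqr.
have [->|t0] := eqVneq t 0; first by rewrite invr0 mul0r.
by rewrite expr2 mulrA mulVf// mul1r.
Qed.

Lemma mean_direction_le1 : sqnorm e <= 1.
Proof.
rewrite -enorm_sqr enormZ normfV (ger0_norm (enorm_ge0 _)).
have [->|t0] := eqVneq t 0; first by rewrite mulr0 expr0n.
by rewrite mulVf// expr1n.
Qed.

Lemma dist_mean_continuous : sphere_continuous (fun x : 'rV[R]_n.+1 => enorm (x - tau)).
Proof.
apply: sphere_continuous_sqrt; apply: sphere_continuous_sum => j.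
apply: sphere_continuousX; under eq_fun do rewrite !mxE.
apply: sphere_continuousB; first exact: sphere_continuous_coord.
exact: sphere_continuous_cst.
Qed.

Lemma variance_density : E (fun x : 'rV[R]_n.+1 => enorm (x - tau) ^+ 2 * density x) = 1 - t ^+ 2.
Proof.
transitivity (E (fun x : 'rV[R]_n.+1 => (1 + t ^+ 2) * density x -
    \sum_j (2 * tau ord0 j) * (x ord0 j * density x))).
  apply: eq_sphere_integral => x Sx.
  rewrite enorm_sqr.
  transitivity ((\sum_j (x ord0 j ^+ 2 - (2 * tau ord0 j * x ord0 j - tau ord0 j ^+ 2))) * density x).
    by congr (_ * _); apply: eq_bigr => j _; rewrite !mxE; ring.
  rewrite sumrB sumrB -[X in (X - _) * _]/(sqnorm x) sqnorm_sphere//.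
  rewrite -[X in _ - (_ - X)]/(sqnorm tau) -enorm_sqr.
  rewrite [X in _ = _ - X](_ : _ = (\sum_j 2 * tau ord0 j * x ord0 j) * density x); last first.
    by rewrite mulr_suml; apply: eq_bigr => j _; rewrite mulrA.
  ring.
rewrite sphere_integralB; last 2 first.
- by apply: sphere_continuousM => //; exact: sphere_continuous_cst.
- apply: sphere_continuous_sum => j.
  by apply: sphere_continuousM => //; exact: sphere_continuous_cst.
rewrite sphere_integralZ// r1 sphere_integral_coord_density.
under eq_bigr do rewrite -mulrA -expr2.
rewrite -mulr_sumr -[X in _ - _ * X]/(sqnorm tau) -enorm_sqr; ring.
Qed.

Definition tangential_sqnorm (x : 'rV[R]_n.+1) : R :=
  sqnorm e - (\sum_j e ord0 j * x ord0 j) ^+ 2.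

Let ec : sphere_continuous (fun x : 'rV[R]_n.+1 => \sum_j e ord0 j * x ord0 j).
Proof.
apply: sphere_continuous_sum => j; apply: sphere_continuousM.
  exact: sphere_continuous_cst.
exact: sphere_continuous_coord.
Qed.

Lemma tangential_sqnorm_continuous : sphere_continuous tangential_sqnorm.
Proof.
apply: sphere_continuousB; first exact: sphere_continuous_cst.
exact: sphere_continuousX.
Qed.

(** By Jensen's inequality the mean of [(e . x)^2] is at least the square of the mean
[t] of [e . x]. *)
Lemma tangential_sqnorm_le : E (fun x : 'rV[R]_n.+1 => tangential_sqnorm x * density x) <= 1 - t ^+ 2.
Proof.
apply: (@le_trans _ _ (E (fun x : 'rV[R]_n.+1 => (1 + t ^+ 2) * density x -
    \sum_j (2 * t * e ord0 j) * (x ord0 j * density x)))).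
  apply: le_sphere_integral.
  - by apply: sphere_continuousM => //; exact: tangential_sqnorm_continuous.
  - apply: sphere_continuousB.
      by apply: sphere_continuousM => //; exact: sphere_continuous_cst.
    apply: sphere_continuous_sum => j.
    by apply: sphere_continuousM => //; exact: sphere_continuous_cst.
  (* the tangent line bound [c ^+ 2 >= 2 * t * c - t ^+ 2] *)
  move=> x Sx; set c := \sum_j e ord0 j * x ord0 j.
  rewrite [X in _ <= _ - X](_ : _ = 2 * t * c * density x); last first.
    by rewrite mulr_sumr mulr_suml; apply: eq_bigr => j _; ring.
  rewrite -mulrBl ler_wpM2r ?density_ge0// /tangential_sqnorm -/c.
  have := mean_direction_le1; have := sqr_ge0 (c - t); nra.
rewrite sphere_integralB; last 2 first.
- by apply: sphere_continuousM => //; exact: sphere_continuous_cst.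
- apply: sphere_continuous_sum => j.
  by apply: sphere_continuousM => //; exact: sphere_continuous_cst.
rewrite sphere_integralZ// r1 sphere_integral_coord_density.
under eq_bigr do rewrite -mulrA.
rewrite -mulr_sumr mean_direction; lra.
Qed.

Lemma integral_half_grad_density :
  E (fun x : 'rV[R]_n.+1 => \sum_j e ord0 j * half_grad_density j x) = n%:R / 2 * t.
Proof.
rewrite sphere_integral_sum => [|j]; last first.
  apply: sphere_continuousM; first exact: sphere_continuous_cst.
  exact: half_grad_density_continuous.
rewrite -mean_direction mulr_sumr; apply: eq_bigr => j _.
rewrite sphere_integralZ; last exact: half_grad_density_continuous.
have ibp := sphere_integral_partial _ _ j _ n_gt0 density_C1.
rewrite (eq_sphere_integral _ _ (partial_density j)) sphere_integralZ in ibp; last first.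
  exact: half_grad_density_continuous.
rewrite mulrCA; congr (_ * _).
have -> : tau ord0 j = E (fun x : 'rV[R]_n.+1 => x ord0 j * density x) by rewrite mxE.
lra.
Qed.

(** [P] and [Q] enter the pointwise bound as their own weights, so that integration
produces their squares. *)
Lemma uncertainty_inequality :
  (n%:R / 2 * t) ^+ 2 + E (fun x : 'rV[R]_n.+1 => enorm (x - tau) * Num.sqrt (W x)) ^+ 2 <=
  E (fun x : 'rV[R]_n.+1 => enorm (x - tau) ^+ 2 * density x) * E grad_sqnorm.
Proof.
have dc := dist_mean_continuous.
have Wc : sphere_continuous (fun x : 'rV[R]_n.+1 => Num.sqrt (W x)).
  apply: sphere_continuous_sqrt; apply: sphere_continuous_sum => j.
  exact/sphere_continuousX/current_continuous.
have bc := tangential_sqnorm_continuous.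
have sc : sphere_continuous (fun x : 'rV[R]_n.+1 => \sum_j e ord0 j * half_grad_density j x).
  apply: sphere_continuous_sum => j; apply: sphere_continuousM.
    exact: sphere_continuous_cst.
  exact: half_grad_density_continuous.
have cst c : sphere_continuous (fun=> c : R) by exact: sphere_continuous_cst.
set P := E (fun x : 'rV[R]_n.+1 => enorm (x - tau) * Num.sqrt (W x)).
set Q := n%:R / 2 * t.
set V := E (fun x : 'rV[R]_n.+1 => _ ^+ 2 * _); set I := E grad_sqnorm.
apply: le_of_quadratic.
- by apply: Rintegral_ge0 => x _; rewrite mulr_ge0 ?sqr_ge0 ?density_ge0.
- apply: Rintegral_ge0 => x _; apply: sumr_ge0 => j _.
  by rewrite addr_ge0 ?sqr_ge0.
- by rewrite addr_ge0 ?sqr_ge0.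
move=> l l0.
have VE : V = 1 - t ^+ 2 by exact: variance_density.
have VB : E (fun x : 'rV[R]_n.+1 => tangential_sqnorm x * density x) <= V.
  by rewrite VE; exact: tangential_sqnorm_le.
have key : E (fun x : 'rV[R]_n.+1 => 2 * l * (P * (enorm (x - tau) * Num.sqrt (W x)) +
      Q * \sum_j e ord0 j * half_grad_density j x)) <=
   E (fun x : 'rV[R]_n.+1 => l ^+ 2 * grad_sqnorm x + (P ^+ 2 * (enorm (x - tau) ^+ 2 * density x) +
      Q ^+ 2 * (tangential_sqnorm x * density x))).
  apply: le_sphere_integral.
  - apply: sphere_continuousM => //; apply: sphere_continuousD.
      by apply: sphere_continuousM => //; exact: sphere_continuousM.
    exact: sphere_continuousM.
  - apply: sphere_continuousD.
      by apply: sphere_continuousM => //; exact: grad_sqnorm_continuous.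
    apply: sphere_continuousD; apply: sphere_continuousM => //.
      by apply: sphere_continuousM => //; exact: sphere_continuousX.
    exact: sphere_continuousM.
  move=> x Sx.
  apply: (@weighted_young _ _ _ _ _ _ _ _ _ (Sg x)).
  - exact: density_ge0.
  - by apply: sumr_ge0 => j _; exact: sqr_ge0.
  - by apply: sumr_ge0 => j _; rewrite addr_ge0 ?sqr_ge0.
  - rewrite subr_ge0 (le_trans (cauchy_schwarz_sum _ _ _ _))//.
    by rewrite -[X in _ * X]/(sqnorm x) sqnorm_sphere// mulr1.
  - rewrite sqr_sqrtr; last by apply: sumr_ge0 => j _; exact: sqr_ge0.
    exact: current_half_grad_density.
  - exact: half_grad_density_tangent.
have pc : sphere_continuous (fun x : 'rV[R]_n.+1 => enorm (x - tau) * Num.sqrt (W x)).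
  exact: sphere_continuousM.
have ac : sphere_continuous (fun x : 'rV[R]_n.+1 => enorm (x - tau) ^+ 2 * density x).
  by apply: sphere_continuousM => //; exact: sphere_continuousX.
have bdc : sphere_continuous (fun x : 'rV[R]_n.+1 => tangential_sqnorm x * density x).
  exact: sphere_continuousM.
have cZ c k : sphere_continuous k -> sphere_continuous (fun x : 'rV[R]_n.+1 => c * k x).
  by move=> ck; exact: sphere_continuousM.
have gc := grad_sqnorm_continuous.
rewrite sphere_integralZ in key; last by apply: sphere_continuousD; exact: cZ.
rewrite sphere_integralD in key; [|exact: cZ|exact: cZ].
rewrite !sphere_integralZ// integral_half_grad_density -/P -/Q in key.
rewrite sphere_integralD in key; [|exact: cZ|by apply: sphere_continuousD; exact: cZ].
rewrite sphere_integralD in key; [|exact: cZ|exact: cZ].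
rewrite !sphere_integralZ// -/V -/I in key.
have := ler_wpM2l (sqr_ge0 Q) VB; move: key; lra.
Qed.

End uncertainty.

(** * Complex-valued functions *)

Section complex_function.
Context {R : realType} {n : nat}.
Context (f : 'rV[R]_n.+1 -> R[i]).
Local Notation u := (fun x => complex.Re (f x)).
Local Notation v := (fun x => complex.Im (f x)).

Lemma normc_sqr (z : R[i]) : Normc.normc z ^+ 2 = complex.Re z ^+ 2 + complex.Im z ^+ 2.
Proof. by case: z => a b; rewrite /Normc.normc sqr_sqrtr// addr_ge0 ?sqr_ge0. Qed.

Lemma normc_density x : Normc.normc (f x) ^+ 2 = density u v x.
Proof. exact: normc_sqr. Qed.

Lemma hnorm_sphere_grad x : hnorm (sphere_grad f x) ^+ 2 = grad_sqnorm u v x.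
Proof.
rewrite sqr_sqrtr; last by apply: sumr_ge0 => j _; exact: sqr_ge0.
by apply: eq_bigr => j _; rewrite mxE normc_sqr.
Qed.

(** At a zero of [f] both sides vanish, in accordance with the convention for the
integrand of the covariance. *)
Lemma hnorm_phase_deriv x : sphere_C1_complex f -> sphere n.+1 x ->
  hnorm (phase_deriv f x) * Normc.normc (f x) ^+ 2 =
  Num.sqrt (\sum_j current u v j x ^+ 2).
Proof.
move=> fC Sx; rewrite phase_derivE//; last exact: sphere_neq0.
have r0 := density_ge0 u v x.
set r := density u v x in r0.
rewrite !normc_density -/r -(ger0_norm r0) -sqrtr_sqr /hnorm.
rewrite -sqrtrM; last by apply: sumr_ge0 => j _; exact: sqr_ge0.
congr Num.sqrt; rewrite mulr_suml; apply: eq_bigr => j _.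
rewrite mxE normc_sqr/= expr0n/= addr0 -/r sqrtr_sqr ger0_norm//.
rewrite -/(current u v j x) expr_div_n.
have [r00|rn0] := eqVneq r 0; last by rewrite divfK// expf_neq0.
move: r00; rewrite /r /density => /eqP; rewrite paddr_eq0 ?sqr_ge0// !sqrf_eq0.
move=> /andP[/eqP u0 /eqP v0].
by rewrite /current u0 v0 !mul0r subrr !expr0n/= !mul0r.
Qed.

End complex_function.

Theorem corollary1p13 (R : realType) (n : nat) (hn : (2 <= n)%N)
    (f : 'rV[R]_n.+1 -> R[i])
    (f_C1 : sphere_C1_complex f)
    (absf_C1 : sphere_C1 (fun x => Normc.normc (f x)))
    (f_norm1 : \int[sphere_measure n.+1]_(x in sphere n.+1)
                 (Normc.normc (f x) ^+ 2) = 1) :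
  variance_position f *
    (\int[sphere_measure n.+1]_(x in sphere n.+1) (hnorm (sphere_grad f x) ^+ 2))
  >= n%:R ^+ 2 / 4 * enorm (mean_position f) ^+ 2 + covariance_abs f ^+ 2.
Proof.
have [uC vC] := f_C1.
have r1 : \int[sphere_measure n.+1]_(x in sphere n.+1)
    density (fun x => complex.Re (f x)) (fun x => complex.Im (f x)) x = 1.
  by rewrite -f_norm1; apply: eq_Rintegral => x _; rewrite normc_density.
have tauE : mean_position f =
    mean_density (fun x => complex.Re (f x)) (fun x => complex.Im (f x)).
  apply/rowP => j; rewrite !mxE; apply: eq_Rintegral => x _.
  by rewrite normc_density.
have := uncertainty_inequality (ltnW hn) _ _ uC vC r1.
rewrite exprMn expr_div_n -natrX -tauE.
rewrite /variance_position /covariance_abs.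
have <- : \int[sphere_measure n.+1]_(x in sphere n.+1)
    (enorm (x - mean_position f) * hnorm (phase_deriv f x) * Normc.normc (f x) ^+ 2) =
  \int[sphere_measure n.+1]_(x in sphere n.+1) (enorm (x - mean_position f) *
     Num.sqrt (\sum_j current (fun x => complex.Re (f x)) (fun x => complex.Im (f x)) j x ^+ 2)).
  apply: eq_sphere_integral => x Sx.
  by rewrite -mulrA hnorm_phase_deriv.
have <- : \int[sphere_measure n.+1]_(x in sphere n.+1)
    (enorm (x - mean_position f) ^+ 2 * Normc.normc (f x) ^+ 2) =
  \int[sphere_measure n.+1]_(x in sphere n.+1) (enorm (x - mean_position f) ^+ 2 *
     density (fun x => complex.Re (f x)) (fun x => complex.Im (f x)) x).
  by apply: eq_Rintegral => x _; rewrite normc_density.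
have <- : \int[sphere_measure n.+1]_(x in sphere n.+1) (hnorm (sphere_grad f x) ^+ 2) =
  \int[sphere_measure n.+1]_(x in sphere n.+1)
     grad_sqnorm (fun x => complex.Re (f x)) (fun x => complex.Im (f x)) x.
  by apply: eq_Rintegral => x _; rewrite hnorm_sphere_grad.
by rewrite (_ : 2 ^+ 2 = 4)// -natrX.
Qed.
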